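(* There is an absolute constant $C>0$ such that the following holds. Let $V$ be a finite set with $n=|V|\ge 2$ and let $\mathcal{P}=(P_t)_{t\ge 1}$ be a sequence of irreducible and reversible transition matrices on $V$ which all have the same stationary distribution $\pi$. Then: (i) $t_{\mathrm{hit}}^{(k)}(\mathcal{P})\le C\left(t_{\mathrm{sep}}^{(\pi)}(\mathcal{P})+\frac{t_{\mathrm{HIT}}(\mathcal{P})}{k}\right)$ for every integer $k\ge 1$. In particular, $t_{\mathrm{hit}}(\mathcal{P})\le C\, t_{\mathrm{HIT}}(\mathcal{P})$ if $P_t$ is lazy for all $t\ge 1$. (ii) $t_{\mathrm{cov}}^{(k)}(\mathcal{P})\le C\left(t_{\mathrm{sep}}^{(\pi)}(\mathcal{P})+\frac{t_{\mathrm{HIT}}(\mathcal{P})\log n}{k}\right)$ for every integer $k\ge 1$. In particular, $t_{\mathrm{cov}}(\mathcal{P})\le C\, t_{\mathrm{HIT}}(\mathcal{P})\log n$ if $P_t$ is lazy for all $t\ge 1$.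
   Context: A transition matrix $P\in[0,1]^{V\times V}$ is a row-stochastic matrix. It is irreducible if for all $u,v$ there is $t>0$ with $P^t(u,v)>0$; lazy if $P(v,v)\ge 1/2$ for all $v$; reversible if $\pi(u)P(u,v)=\pi(v)P(v,u)$ for all $u,v$, where $\pi$ is its stationary distribution. A random walk according to $\mathcal{P}$ is a time-inhomogeneous Markov chain $(X_t)_{t\ge0}$ with $\Pr[X_t=v\mid X_{t-1}=u]=P_t(u,v)$ for $t\ge1$. Consider $k$ independent random walks $(X_t(1))_{t\ge0},\dots,(X_t(k))_{t\ge0}$, each according to $\mathcal{P}$, and $X_t=(X_t(1),\dots,X_t(k))$. Let $\tau_{\mathrm{hit}}^{(k)}(\mathcal{P},w)=\inf\{t\ge0: w\in\bigcup_{i\in[k],0\le s\le t}\{X_s(i)\}\}$ and $\tau_{\mathrm{cov}}^{(k)}(\mathcal{P})=\inf\{t\ge0:\bigcup_{i\in[k],0\le s\le t}\{X_s(i)\}=V\}$. Then $t_{\mathrm{hit}}^{(k)}(\mathcal{P})=\max_{x\in V^k,w\in V}\mathbf{E}[\tau_{\mathrm{hit}}^{(k)}(\mathcal{P},w)\mid X_0=x]$, $t_{\mathrm{cov}}^{(k)}(\mathcal{P})=\max_{x\in V^k}\mathbf{E}[\tau_{\mathrm{cov}}^{(k)}(\mathcal{P})\mid X_0=x]$, $t_{\mathrm{hit}}=t_{\mathrm{hit}}^{(1)}$, $t_{\mathrm{cov}}=t_{\mathrm{cov}}^{(1)}$. For a single matrix $P$, $t_{\mathrm{hit}}(P)$ is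 $t_{\mathrm{hit}}$ of the constant sequence $P,P,\dots$, and $t_{\mathrm{HIT}}(\mathcal{P})=\max_{t\ge 1}t_{\mathrm{hit}}(P_t)$ (read as a supremum, assumed finite). $t_{\mathrm{sep}}^{(\pi)}(\mathcal{P})=\min\left\{t\ge 0:\max_{s\ge 0,\,u,v\in V}\left(1-\frac{(P_{s+1}P_{s+2}\cdots P_{s+t})(u,v)}{\pi(v)}\right)\le\frac12\right\}$ (supremum over $s$; $+\infty$ if the set is empty, in which case the bounds involving it are vacuous). *)

(* Defs.v *)
From HB Require Import structures.
From mathcomp Require Import all_boot all_order all_algebra.
From mathcomp Require Import all_classical all_reals all_analysis.
Set Implicit Arguments.
Unset Strict Implicit.
Unset Printing Implicit Defensive.
Import Order.TTheory GRing.Theory Num.Theory.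
Import numFieldNormedType.Exports.
Local Open Scope classical_set_scope.
Local Open Scope ring_scope.

(* A V x V matrix is a library matrix of size #|V|; rows and columns are
   labelled by V through enum_rank, so that the library's product and powers
   apply. *)
Definition entry (R : realType) (V : finType) (P : 'M[R]_#|V|) (u v : V) : R :=
  P (enum_rank u) (enum_rank v).

Definition transition_matrix (R : realType) (V : finType) (P : 'M[R]_#|V|) :=
  (forall u v, 0 <= entry P u v <= 1) /\ (forall u, \sum_v entry P u v = 1).

Definition irreducible (R : realType) (V : finType) (P : 'M[R]_#|V|) :=
  forall u v, exists2 t : nat, (0 < t)%N & 0 < entry (P ^+ t) u v.

Definition lazy (R : realType) (V : finType) (P : 'M[R]_#|V|) :=
  forall v, 1 / 2 <= entry P v v.

Definition distribution_on (R : realType) (V : finType) (p : V -> R) :=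
  (forall v, 0 <= p v) /\ \sum_v p v = 1.

Definition stationary (R : realType) (V : finType) (p : V -> R)
    (P : 'M[R]_#|V|) :=
  distribution_on p /\ forall v, \sum_u p u * entry P u v = p v.

Definition reversible (R : realType) (V : finType) (p : V -> R)
    (P : 'M[R]_#|V|) :=
  forall u v, p u * entry P u v = p v * entry P v u.

(* In a sequence P : nat -> 'M_#|V| of transition matrices, P t drives the step
   from time t - 1 to time t; the value P 0 is never used. *)

(* The Markov property is written in product form: for every history
   h 0, ..., h t and every next state v,
   Pr[X_0 = h 0, ..., X_t = h t, X_(t+1) = v]
     = Pr[X_0 = h 0, ..., X_t = h t] * P_(t+1)(h t, v),
   which does not need the history to have positive probability. *)
Definition random_walk (R : realType) (V : finType) (P : nat -> 'M[R]_#|V|)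
    (d : measure_display) (T : measurableType d) (Pr : probability T R)
    (X : nat -> T -> V) :=
  (forall t v, measurable [set o | X t o = v]) /\
  (forall (t : nat) (h : nat -> V) (v : V),
     Pr [set o | (forall s, (s <= t)%N -> X s o = h s) /\ X t.+1 o = v] =
     (Pr [set o | forall s, (s <= t)%N -> X s o = h s]
       * (entry (P t.+1) (h t) v)%:E)%E).

(* Mutual independence of the k processes. The A i are arbitrary sets of
   trajectories up to time t; since A i may be everything, the product rule for
   subfamilies is included. *)
Definition independent_walks (R : realType) (V : finType) (k : nat)
    (d : measure_display) (T : measurableType d) (Pr : probability T R)
    (X : 'I_k -> nat -> T -> V) :=
  forall (t : nat) (A : 'I_k -> set (t.+1.-tuple V)),
    Pr [set o | forall i, A i [tuple X i s o | s < t.+1]] =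
    (\prod_(i < k) Pr [set o | A i [tuple X i s o | s < t.+1]])%E.

Definition random_walks (R : realType) (V : finType) (k : nat)
    (P : nat -> 'M[R]_#|V|) (d : measure_display) (T : measurableType d)
    (Pr : probability T R) (X : 'I_k -> nat -> T -> V) :=
  (forall i, random_walk P Pr (X i)) /\ independent_walks Pr X.

Definition visited (V : finType) (k : nat) (x : 'I_k -> nat -> V) (t : nat) :
    set V :=
  [set v | exists (i : 'I_k) (s : nat), (s <= t)%N /\ x i s = v].

(* The infimum of the empty set is +oo. *)
Definition inf_time (R : realType) (A : set nat) : \bar R :=
  ereal_inf [set (t%:R)%:E | t in A].

Definition tau_hit (R : realType) (V : finType) (k : nat)
    (x : 'I_k -> nat -> V) (w : V) : \bar R :=
  inf_time R [set t | visited x t w].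

Definition tau_cov (R : realType) (V : finType) (k : nat)
    (x : 'I_k -> nat -> V) : \bar R :=
  inf_time R [set t | visited x t = setT].

(* E[f | A], for an event A of positive probability. *)
Definition cond_expectation (R : realType) (d : measure_display)
    (T : measurableType d) (Pr : probability T R) (A : set T)
    (f : T -> \bar R) : \bar R :=
  ((fine (Pr A))^-1%:E * \int[Pr]_(o in A) f o)%E.

(* cond_values P x f e: on some probability space carrying k independent walks
   X according to P with Pr[X_0 = x] > 0, e is the conditional expectation given
   X_0 = x of the functional f of the trajectories. Conditionally on X_0 = x the
   law of the trajectories is determined by P and x, so the value e is the same
   for all realisations of the walks; a supremum over realisations is thus just
   this common value. *)
Definition cond_values (R : realType) (V : finType) (k : nat)
    (P : nat -> 'M[R]_#|V|) (x : 'I_k -> V)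
    (f : ('I_k -> nat -> V) -> \bar R) : set (\bar R) :=
  [set e | exists (d : measure_display) (T : measurableType d)
             (Pr : probability T R) (X : 'I_k -> nat -> T -> V),
       [/\ random_walks P Pr X,
           (0 < Pr [set o | forall i, X i 0%N o = x i])%E &
           e = cond_expectation Pr [set o | forall i, X i 0%N o = x i]
                 (fun o => f (fun i t => X i t o))]].

Definition t_hit (R : realType) (V : finType) (k : nat)
    (P : nat -> 'M[R]_#|V|) : \bar R :=
  ereal_sup [set e | exists (x : 'I_k -> V) (w : V),
                       cond_values P x (fun y => tau_hit R y w) e].

Definition t_cov (R : realType) (V : finType) (k : nat)
    (P : nat -> 'M[R]_#|V|) : \bar R :=
  ereal_sup [set e | exists x : 'I_k -> V,
                       cond_values P x (fun y => tau_cov R y) e].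

Definition t_HIT (R : realType) (V : finType) (P : nat -> 'M[R]_#|V|) :
    \bar R :=
  ereal_sup [set t_hit 1 (fun=> P t) | t in [set t | (1 <= t)%N]].

Definition sep_dist (R : realType) (V : finType) (p : V -> R)
    (P : nat -> 'M[R]_#|V|) (t : nat) : \bar R :=
  ereal_sup [set e | exists (s : nat) (u v : V),
    e = (1 - entry (\prod_(s.+1 <= r < (s + t).+1) P r) u v / p v)%:E].

Definition t_sep (R : realType) (V : finType) (p : V -> R)
    (P : nat -> 'M[R]_#|V|) : \bar R :=
  inf_time R [set t | (sep_dist p P t <= (1 / 2)%:E)%E].

(* Main.v *)
(* Write H for t_HIT.

   Hitting from stationarity. For a fixed reversible kernel with target w, the
   expected hitting time h satisfies h = 1 + K h off w and 0 <= h <= H, so Barta's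
   trick with the supersolution h shows that the kernel killed at w contracts
   L^2(p) by the factor 1 - 1/H on squared norms. This is a one-step estimate,
   hence it survives when the kernel changes with time: from p, the walk avoids w
   for b steps with probability at most exp (- b / 2H).

   From arbitrary starts. After t_sep steps each walker is with probability 1/2
   distributed as p, so with probability at least 1/2 at least half of the k
   walkers are. A union bound over a target set U then shows that an epoch of
   t_sep + 4 H (1 + ln |U|) / k steps covers U with probability at least 1/4;
   restarting the epochs bounds the expected cover time of U. Singletons give
   hitting times, U = V gives cover times.

   Lazy chains. Pairing f with (I - K) h = 1 - delta_w / p(w) and Cauchy-Schwarz
   give (f(w) - p(f))^2 <= H E(f, f) for the Dirichlet form E. For the density g
   of the walk, D = |g|^2 - 1 <= sup |g - 1|, so D decreases by at least D^2 / H
   in a lazy step, whence D <= H / t after t steps from a point. Splitting the time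
   interval into two halves turns this into t_sep <= C H.

   As t_HIT is a supremum over realisations, using it as an upper bound for the
   expected hitting times requires that homogeneous chains can be realised. *)

Require Import Defs.
From HB Require Import structures.
From mathcomp Require Import all_boot all_order all_algebra.
From mathcomp Require Import all_classical all_reals all_analysis.
From mathcomp Require Import ring lra zify.
Set Implicit Arguments.
Unset Strict Implicit.
Unset Printing Implicit Defensive.
Import Order.TTheory GRing.Theory Num.Theory.
Import numFieldNormedType.Exports.
Local Open Scope classical_set_scope.
Local Open Scope ring_scope.

(** * Reversible kernels and hitting potentials *)

Section Kernels.
Variables (R : realType) (V : finType).
Implicit Types (p f g h : V -> R) (K : V -> V -> R).

Definition stochastic K := (forall u v, 0 <= K u v) /\ (forall u, \sum_v K u v = 1).

Definition rev_wrt p K := forall u v, p u * K u v = p v * K v u.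

Definition app K f (u : V) : R := \sum_v K u v * f v.

Definition dot p f g : R := \sum_x p x * (f x * g x).

Lemma dotC p f g : dot p f g = dot p g f.
Proof. by apply: eq_bigr => x _; rewrite (mulrC (f x)). Qed.

Lemma dot_lin p f g g' (a b : R) :
  dot p f (fun x => a * g x + b * g' x) = a * dot p f g + b * dot p f g'.
Proof.
rewrite /dot !mulr_sumr -big_split; apply: eq_bigr => x _ /=; ring.
Qed.

Lemma dot_linl p f f' g (a b : R) :
  dot p (fun x => a * f x + b * f' x) g = a * dot p f g + b * dot p f' g.
Proof. by rewrite dotC dot_lin !(dotC p g). Qed.

Lemma dot_ge0 p f : (forall v, 0 <= p v) -> 0 <= dot p f f.
Proof. by move=> p0; apply: sumr_ge0 => x _; rewrite mulr_ge0// -expr2 sqr_ge0. Qed.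

Lemma app_lin K f g (a b : R) u :
  app K (fun x => a * f x + b * g x) u = a * app K f u + b * app K g u.
Proof.
rewrite /app !mulr_sumr -big_split; apply: eq_bigr => x _ /=; ring.
Qed.

Lemma dot_app p K f g :
  dot p f (app K g) = \sum_x \sum_y p x * K x y * (f x * g y).
Proof.
apply: eq_bigr => x _; rewrite /app !mulr_sumr; apply: eq_bigr => y _; ring.
Qed.

Lemma dot_appC p K f g : rev_wrt p K -> dot p f (app K g) = dot p (app K f) g.
Proof.
move=> rK; rewrite dot_app dotC dot_app exchange_big/=.
by apply: eq_bigr => x _; apply: eq_bigr => y _; rewrite rK (mulrC (f y)).
Qed.

Lemma dot_app1 p K f : rev_wrt p K -> stochastic K ->
  dot p (fun=> 1) (app K f) = dot p (fun=> 1) f.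
Proof.
move=> rK [_ K1]; rewrite dot_appC//; apply: eq_bigr => x _; congr (_ * (_ * _)).
by rewrite -[RHS](K1 x); apply: eq_bigr => y _; rewrite mulr1.
Qed.

Lemma sqr_mean_le p f : (forall v, 0 <= p v) -> \sum_v p v = 1 ->
  (dot p (fun=> 1) f) ^+ 2 <= dot p f f.
Proof.
move=> p0 p1; pose one : V -> R := fun=> 1; rewrite -/one; set m := dot _ _ f.
have := dot_ge0 (fun x => 1 * f x + (- m) * one x) p0.
rewrite dot_lin !dot_linl (dotC p f one) -/m.
have -> : dot p one one = 1.
  by rewrite -[RHS]p1; apply: eq_bigr => x _; rewrite !mulr1.
by rewrite !mul1r => ?; rewrite expr2; lra.
Qed.

Section reversible_kernel.
Variables (p : V -> R) (K : V -> V -> R).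
Hypotheses (p0 : forall v, 0 <= p v) (sK : stochastic K) (rK : rev_wrt p K).

Lemma rev_sum_l f : \sum_x \sum_y p x * K x y * f x = \sum_x p x * f x.
Proof.
apply: eq_bigr => x _; rewrite -[RHS]mulr1 -(sK.2 x) mulr_sumr.
by apply: eq_bigr => y _; ring.
Qed.

Lemma rev_sum_r f : \sum_x \sum_y p x * K x y * f y = \sum_x p x * f x.
Proof.
rewrite exchange_big/= -rev_sum_l.
by apply: eq_bigr => x _; apply: eq_bigr => y _; rewrite rK.
Qed.

Lemma dot_app_le f g : dot p f (app K g) <= (dot p f f + dot p g g) / 2.
Proof.
rewrite dot_app {1}/dot -(rev_sum_l (fun x => f x * f x)) {1}/dot.
rewrite -(rev_sum_r (fun x => g x * g x)) -big_split/= mulr_suml.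
apply: ler_sum => x _; rewrite -big_split/= mulr_suml.
apply: ler_sum => y _; rewrite -mulrDr -(mulrA (p x * K x y)) ler_wpM2l//.
  by rewrite mulr_ge0// sK.1.
by rewrite ler_pdivlMr// -subr_ge0; have := sqr_ge0 (f x - g y); rewrite expr2; nra.
Qed.

Lemma dirichlet_ge0 f : 0 <= dot p f f - dot p f (app K f).
Proof. by have := dot_app_le f f; lra. Qed.

Lemma app_contraction f : dot p (app K f) (app K f) <= dot p f f.
Proof. by have := dot_app_le (app K f) f; lra. Qed.

End reversible_kernel.

Lemma lazy_contraction p K f : (forall v, 0 <= p v) -> stochastic K ->
  rev_wrt p K -> (forall v, 1 / 2 <= K v v) ->
  dot p (app K f) (app K f) <= dot p f (app K f).
Proof.
move=> p0 sK rK lK.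
pose L u v : R := 2 * K u v - (u == v)%:R.
have appL g u : app L g u = 2 * app K g u + (-1) * g u.
  rewrite /app /L (eq_bigr (fun v => 2 * (K u v * g v) + (-1) * ((u == v)%:R * g v))); last first.
    by move=> v _; ring.
  rewrite big_split/= -!mulr_sumr; congr (_ + _ * _).
  rewrite (bigD1 u)//= eqxx mul1r big1 ?addr0// => v vu.
  by rewrite eq_sym (negbTE vu) mul0r.
have sL : stochastic L.
  split=> u => [v|].
    rewrite /L; case: eqVneq => [->|_]; first by rewrite mulr1n; have := lK v; lra.
    by rewrite subr0 mulr_ge0// sK.1.
  have := appL (fun=> 1) u; rewrite /app.
  under eq_bigr do rewrite mulr1.
  by move=> ->; under eq_bigr do rewrite mulr1; rewrite sK.2; lra.
have rL : rev_wrt p L.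
  move=> u v; rewrite /L eq_sym; case: eqVneq => [->//|_].
  by rewrite !subr0; have := rK u v; lra.
have := app_contraction p0 sL rL f.
have -> : app L f = fun x => 2 * app K f x + (-1) * f x by apply/funext.
rewrite dot_lin !dot_linl.
rewrite (dotC p (app K f) f); lra.
Qed.

Definition killed K (w : V) f (x : V) : R := (x != w)%:R * app K f x.

Definition hit_potential (H : R) K (w : V) h :=
  [/\ h w = 0, forall x, 0 <= h x <= H &
      forall x, x != w -> h x = 1 + app K h x].

Section hitting_potential.
Variables (p : V -> R) (K : V -> V -> R) (H : R) (w : V) (h : V -> R).
Hypotheses (p0 : forall v, 0 <= p v) (sK : stochastic K) (rK : rev_wrt p K).
Hypothesis hh : hit_potential H K w h.

Lemma hit_potential_ge1 x : x != w -> 1 <= h x.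
Proof.
move=> xw; have [_ h0 ->//] := hh; rewrite lerDl.
by apply: sumr_ge0 => y _; rewrite mulr_ge0 ?sK.1//; case/andP: (h0 y).
Qed.

Hypothesis H1 : 1 <= H.

Let H_gt0 : 0 < H. Proof. exact: lt_le_trans H1. Qed.

(* Barta's trick: the potential h is a supersolution, which bounds the top of
   the spectrum of the kernel killed at w. *)
Lemma killed_form_le f g : f w = 0 -> g w = 0 ->
  dot p f (app K g) <= (1 - H^-1) * ((dot p f f + dot p g g) / 2).
Proof.
move=> fw gw; have [hw h0 hE] := hh.
have key e : e w = 0 ->
    \sum_x \sum_y p x * K x y * (e x ^+ 2 * (h y / h x)) <= (1 - H^-1) * dot p e e.
  move=> ew; rewrite /dot mulr_sumr; apply: ler_sum => x _.
  have -> : \sum_y p x * K x y * (e x ^+ 2 * (h y / h x)) =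
            p x * e x ^+ 2 / h x * app K h x.
    by rewrite /app mulr_sumr; apply: eq_bigr => y _; ring.
  have [->|xw] := eqVneq x w; first by rewrite ew expr0n/= !(mulr0,mul0r).
  have h1 := hit_potential_ge1 xw.
  have -> : app K h x = h x - 1 by rewrite hE//; ring.
  have -> : p x * e x ^+ 2 / h x * (h x - 1) = p x * e x ^+ 2 * (1 - (h x)^-1).
    by field; apply/eqP; lra.
  rewrite -expr2 [X in _ <= X]mulrC ler_wpM2l//; first by rewrite mulr_ge0// sqr_ge0.
  rewrite lerD2l lerN2 lef_pV2; first by case/andP: (h0 x).
  - by rewrite posrE.
  - by rewrite posrE (lt_le_trans ltr01).
have : dot p f (app K g) <= (\sum_x \sum_y p x * K x y * (f x ^+ 2 * (h y / h x)) +
    \sum_x \sum_y p x * K x y * (g x ^+ 2 * (h y / h x))) / 2.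
  rewrite [X in _ + X]exchange_big/= dot_app -big_split/= mulr_suml.
  apply: ler_sum => x _; rewrite -big_split/= mulr_suml; apply: ler_sum => y _.
  rewrite (rK y x) -mulrDr -(mulrA (p x * K x y)) ler_wpM2l//; first by rewrite mulr_ge0// sK.1.
  have [->|xw] := eqVneq x w; first by rewrite fw hw expr0n/= invr0 !(mulr0,mul0r,addr0).
  have [->|yw] := eqVneq y w; first by rewrite gw hw expr0n/= invr0 !(mulr0,mul0r,addr0).
  have hx := hit_potential_ge1 xw; have hy := hit_potential_ge1 yw.
  have hxy : 0 < h x * h y by rewrite mulr_gt0//; lra.
  rewrite ler_pdivlMr// -subr_ge0.
  have -> : f x ^+ 2 * (h y / h x) + g y ^+ 2 * (h x / h y) - f x * g y * 2 =
     (f x * h y - g y * h x) ^+ 2 / (h x * h y).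
    by field; apply/andP; split; apply/eqP; lra.
  by rewrite divr_ge0 ?sqr_ge0// ltW.
have := key f fw; have := key g gw; nra.
Qed.

Lemma killed_contraction g :  g w = 0 ->
  dot p (killed K w g) (killed K w g) <= (1 - H^-1) * dot p g g.
Proof.
move=> gw; set f := killed K w g.
have fw : f w = 0 by rewrite /f /killed eqxx mul0r.
have -> : dot p f f = dot p f (app K g).
  by apply: eq_bigr => x _; rewrite /f /killed; case: eqVneq; rewrite ?mul0r ?mul1r.
have := killed_form_le fw gw.
have -> : dot p f (app K g) = dot p f f.
  by apply: eq_bigr => x _; rewrite /f /killed; case: eqVneq; rewrite ?mul0r ?mul1r.
have f0 := dot_ge0 f p0; have g0 := dot_ge0 g p0.
have : 0 < H^-1 by rewrite invr_gt0.
have : H^-1 <= 1 by rewrite invf_le1.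
set c := H^-1; nra.
Qed.

(* (I - K) h = 1 - delta_w / p w, so pairing f with it gives mean f - f w. *)
Lemma potential_pairing f : \sum_v p v = 1 ->
  dot p f h - dot p f (app K h) = dot p (fun=> 1) f - f w.
Proof.
move=> p1; have [hw h0 hE] := hh.
have pair e : dot p e h - dot p e (app K h) =
    dot p (fun=> 1) e - p w * e w - p w * e w * app K h w.
  rewrite /dot -sumrB (bigD1 w)//= [in RHS](bigD1 w)//= hw.
  rewrite (eq_bigr (fun v => p v * (1 * e v))); first by ring.
  by move=> v vw; rewrite (hE v vw); ring.
have := pair (fun=> 1); rewrite dot_app1// subrr.
have -> : dot p (fun=> 1) (fun=> 1) = 1.
  by rewrite -[RHS]p1; apply: eq_bigr => x _; rewrite !mulr1.
by move=> /(congr1 (fun c => f w * c)) E; rewrite pair; lra.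
Qed.

Lemma sup_dirichlet f : \sum_v p v = 1 ->
  (f w - dot p (fun=> 1) f) ^+ 2 <= H * (dot p f f - dot p f (app K f)).
Proof.
move=> p1; have [hw h0 hE] := hh.
set b := _ - _; pose t := - b / H.
have := dirichlet_ge0 p0 sK rK (fun x => 1 * f x + (- t) * h x).
set e := fun x => _.
have -> : dot p e (app K e) = 1 * dot p e (app K f) + (- t) * dot p e (app K h).
  by rewrite -dot_lin; congr dot; apply/funext => x; rewrite /e app_lin.
rewrite dot_lin !dot_linl.
have hf := potential_pairing f p1; have hh' := potential_pairing h p1.
have e1 : dot p h (app K f) = dot p f (app K h) by rewrite (dot_appC _ _ rK) dotC.
rewrite e1 (dotC p h f).
have mh : dot p (fun=> 1) h <= H.
  rewrite -[leRHS]mulr1 -[X in _ <= _ * X]p1 mulr_sumr; apply: ler_sum => x _.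
  by rewrite mul1r mulrC ler_wpM2r//; case/andP: (h0 x).
have -> : 1 * (1 * dot p f f + - t * dot p f h) +
    - t * (1 * dot p f h + - t * dot p h h) -
    (1 * (1 * dot p f (app K f) + - t * dot p f (app K h)) +
    - t * (1 * dot p f (app K h) + - t * dot p h (app K h))) =
    (dot p f f - dot p f (app K f)) - 2 * t * (dot p f h - dot p f (app K h))
      + t ^+ 2 * (dot p h h - dot p h (app K h)) by ring.
rewrite hf hh' hw subr0.
set D := dot p f f - _; set m := dot p _ h in mh *.
have -> : dot p (fun=> 1) f - f w = - b by rewrite /b; ring.
move=> le0.
have t2 : t ^+ 2 * m <= t ^+ 2 * H by rewrite ler_wpM2l// sqr_ge0.
have tH : t * H = - b by rewrite /t divfK// gt_eqF.
have tt : t ^+ 2 * H = - b * t by rewrite expr2 -mulrA tH mulrC.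
have : b * t = - (b ^+ 2 / H) by rewrite /t; field; rewrite gt_eqF.
move=> bt; have : b ^+ 2 / H <= D by nra.
by rewrite ler_pdivrMr ?[H * _]mulrC//; lra.
Qed.

End hitting_potential.
End Kernels.

(** * Time-inhomogeneous walks *)

Section InhomogeneousChain.
Variables (R : realType) (V : finType).
Implicit Types (p f g : V -> R) (K : nat -> V -> V -> R).

(* Probability that the walk started from x at time s avoids w up to time s + t. *)
Fixpoint miss K (s t : nat) (w x : V) : R :=
  if t is t'.+1 then killed (K s.+1) w (miss K s.+1 t' w) x else (x != w)%:R.

Fixpoint trans K (s t : nat) (u v : V) : R :=
  if t is t'.+1 then \sum_y K s.+1 u y * trans K s.+1 t' y v else (u == v)%:R.

Lemma miss_target K s t w : miss K s t w w = 0.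
Proof. by case: t => [|t] /=; rewrite /killed eqxx ?mul0r. Qed.

Lemma miss_bounds K s t w x : (forall r, stochastic (K r.+1)) ->
  0 <= miss K s t w x <= 1.
Proof.
move=> sK; elim: t s x => [|t IH] s x /=; first by case: (_ != _); rewrite /= ?lexx ?ler01.
have [K0 K1] := sK s.
rewrite /killed; case: (_ != _) => /=; last by rewrite mul0r lexx ler01.
rewrite mul1r /app; apply/andP; split.
  by apply: sumr_ge0 => y _; rewrite mulr_ge0//; case/andP: (IH s.+1 y).
rewrite -[leRHS](K1 x); apply: ler_sum => y _.
by rewrite ler_piMr//; case/andP: (IH s.+1 y).
Qed.

Lemma trans_recr K s t u v :
  trans K s t.+1 u v = \sum_y trans K s t u y * K (s + t).+1 y v.
Proof.
elim: t s u => [|t IH] s u.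
  rewrite /= addn0 (bigD1 v)//= eqxx mulr1 big1 ?addr0; last first.
    by move=> y /negbTE ->; rewrite mulr0.
  rewrite (bigD1 u)//= eqxx mul1r big1 ?addr0// => y yu.
  by rewrite eq_sym (negbTE yu) mul0r.
rewrite [LHS]/= (eq_bigr (fun y => \sum_z K s.+1 u y * (trans K s.+1 t y z * K (s + t.+1).+1 z v))).
  rewrite exchange_big/=; apply: eq_bigr => z _; rewrite mulr_suml.
  by apply: eq_bigr => y _; rewrite mulrA.
by move=> y _; rewrite -mulr_sumr; congr (_ * _); rewrite -addSnnS -IH.
Qed.

Lemma trans_add K s a b u v :
  trans K s (a + b) u v = \sum_y trans K s a u y * trans K (s + a) b y v.
Proof.
elim: a s u => [|a IH] s u.
  rewrite /= addn0 (bigD1 u)//= eqxx mul1r big1 ?addr0// => y yu.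
  by rewrite eq_sym (negbTE yu) mul0r.
rewrite /= (eq_bigr (fun z => \sum_y K s.+1 u z * (trans K s.+1 a z y * trans K (s + a.+1) b y v))).
  rewrite exchange_big/=; apply: eq_bigr => y _; rewrite mulr_suml.
  by apply: eq_bigr => z _; rewrite mulrA.
by move=> z _; rewrite IH mulr_sumr addSnnS.
Qed.

Lemma trans_ge0 K s t u v : (forall r, stochastic (K r.+1)) -> 0 <= trans K s t u v.
Proof.
move=> sK; elim: t s u => [|t IH] s u /=; first by case: (_ == _); rewrite /= ?ler01.
by apply: sumr_ge0 => y _; rewrite mulr_ge0//; have [] := sK s.
Qed.

Lemma trans_sum K s t u : (forall r, stochastic (K r.+1)) -> \sum_v trans K s t u v = 1.
Proof.
move=> sK; elim: t s u => [|t IH] s u /=.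
  rewrite (bigD1 u)//= eqxx big1 ?addr0// => y yu.
  by rewrite eq_sym (negbTE yu).
rewrite exchange_big/= -[RHS](proj2 (sK s) u); apply: eq_bigr => y _.
by rewrite -mulr_sumr IH mulr1.
Qed.

Section reversible_sequence.
Variables (p : V -> R) (K : nat -> V -> V -> R) (H : R).
Hypotheses (p_gt0 : forall v, 0 < p v) (p1 : \sum_v p v = 1).
Hypotheses (sK : forall t, stochastic (K t.+1)) (rK : forall t, rev_wrt p (K t.+1)).
Hypothesis H1 : 1 <= H.
Hypothesis pot : forall t w, exists h, hit_potential H (K t.+1) w h.

Let p0 v : 0 <= p v. Proof. exact: ltW. Qed.
Let H_gt0 : 0 < H. Proof. exact: lt_le_trans H1. Qed.

Let mean f := dot p (fun=> 1) f.

Lemma mean_miss_le s t w : mean (miss K s t w) <= expR (- (t%:R / (2 * H))).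
Proof.
have c0 : 0 <= 1 - H^-1 by rewrite subr_ge0 invf_le1.
have le1 : dot p (miss K s t w) (miss K s t w) <= (1 - H^-1) ^+ t.
  elim: t s => [|t IH] s /=.
    rewrite expr0 -[leRHS]p1; apply: ler_sum => x _.
    by case: (_ != _) => /=; rewrite ?mulr1 ?mulr0.
  have [h hh] := pot s w.
  apply: (le_trans (killed_contraction p0 (sK s) (rK s) hh H1 (miss_target K s.+1 t w))).
  by rewrite exprS ler_wpM2l.
rewrite -(@ler_pXn2r _ 2)// ?nnegrE ?expR_ge0//; last first.
  by apply: sumr_ge0 => x _; rewrite mulr_ge0// mul1r; case/andP: (miss_bounds s t w x sK).
apply: (le_trans (sqr_mean_le (miss K s t w) p0 p1)); apply: (le_trans le1).
rewrite -expRM_natl mulrN.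
have -> : 2%:R * (t%:R / (2 * H)) = t%:R * H^-1 :> R by field; rewrite gt_eqF.
rewrite -mulrN expRM_natl; apply: lerXn2r; rewrite ?nnegrE ?expR_ge0//.
by rewrite expR_ge1Dx.
Qed.

Hypothesis lK : forall t v, 1 / 2 <= K t.+1 v v.

Lemma excess_step s g : (forall x, 0 <= g x) -> mean g = 1 ->
  dot p (app (K s.+1) g) (app (K s.+1) g) - 1 <=
  (dot p g g - 1) - (dot p g g - 1) ^+ 2 / H.
Proof.
move=> g0 g1.
have := lazy_contraction g p0 (sK s) (rK s) (lK s).
set E := dot p g g - dot p g (app (K s.+1) g).
have sup w : (g w - 1) ^+ 2 <= H * E.
  have [h hh] := pot s w.
  by have := sup_dirichlet p0 (sK s) (rK s) hh H1 g p1; rewrite -/(mean g) g1.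
have E0 : 0 <= E by exact: dirichlet_ge0.
have HE0 : 0 <= H * E by rewrite mulr_ge0// ltW.
set d := dot p g g - 1.
have d0 : 0 <= d by rewrite subr_ge0 -[X in X <= _](expr1n _ 2) -g1 sqr_mean_le.
have dle : d <= Num.sqrt (H * E).
  rewrite /d -g1 /mean /dot -sumrB -[leRHS]mulr1 -[X in _ <= _ * X]g1 /mean/dot mulr_sumr.
  apply: ler_sum => x _; rewrite mul1r.
  have -> : p x * (g x * g x) - p x * g x = p x * g x * (g x - 1) by ring.
  rewrite [leRHS]mulrC ler_wpM2l//; first by rewrite mulr_ge0.
  by rewrite (le_trans (ler_norm _))// -sqrtr_sqr ler_sqrt// sup.
have : d ^+ 2 <= H * E by rewrite -(sqr_sqrtr HE0) ler_pXn2r// nnegrE ?sqrtr_ge0.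
rewrite mulrC -ler_pdivrMr// => dE le1.
have eg : dot p g (app (K s.+1) g) = d + 1 - E by rewrite /d /E; ring.
by rewrite eg in le1; lra.
Qed.

Lemma decay_step (t : nat) (d d' : R) :
  0 <= d -> t%:R * d <= H -> d' <= d - d ^+ 2 / H -> t.+1%:R * d' <= H.
Proof.
move=> d0 td dd; have h1 := H_gt0.
apply: (le_trans (ler_wpM2l (ler0n _ _) dd)).
pose y := d / H.
have dy : d = y * H by rewrite /y divfK// gt_eqF.
have -> : d - d ^+ 2 / H = H * (y * (1 - y)) by rewrite dy; field; rewrite gt_eqF.
have y0 : 0 <= y by rewrite divr_ge0// ltW.
have ty : t%:R * y <= 1 by rewrite /y mulrA ler_pdivrMr// mul1r.
rewrite mulrCA ler_piMr// ?ltW//.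
have n0 : 0 <= t%:R :> R by exact: ler0n.
rewrite -natr1; have [?|?] := leP ((t%:R + 1) * y) 1; nra.
Qed.

Lemma mean_col s t v : mean (fun y => trans K s t y v / p v) = 1.
Proof.
rewrite -[RHS](@divff _ (p v)); last by rewrite gt_eqF.
rewrite /mean /dot (eq_bigr (fun y => (p y * trans K s t y v) / p v)); last by move=> y _; ring.
rewrite -mulr_suml; congr (_ / _).
elim: t s => [|t IH] s /=.
  rewrite (bigD1 v)//= eqxx mulr1 big1 ?addr0// => y /negbTE ->.
  by rewrite mulr0.
rewrite -(IH s.+1) (eq_bigr (fun y => \sum_z p z * K s.+1 z y * trans K s.+1 t z v)).
  rewrite exchange_big/=; apply: eq_bigr => z _; rewrite -mulr_suml -mulr_sumr.
  by rewrite (proj2 (sK s)) mulr1.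
by move=> y _; rewrite mulr_sumr; apply: eq_bigr => z _; rewrite mulrA (rK s y z).
Qed.

Lemma col_decay s t v :
  let g := fun y => trans K s t y v / p v in t%:R * (dot p g g - 1) <= H.
Proof.
elim: t s => [|t IH] s; cbv zeta; first by rewrite mul0r ltW.
set g := fun y => trans K s.+1 t y v / p v.
have -> : (fun y => trans K s t.+1 y v / p v) = app (K s.+1) g.
  apply/funext => y; rewrite /app mulr_suml; apply: eq_bigr => z _.
  by rewrite mulrA.
have g1 : mean g = 1 by exact: mean_col.
apply: decay_step (IH s.+1) _.
  by rewrite subr_ge0 -[X in X <= _](expr1n _ 2) -g1 sqr_mean_le.
apply: excess_step => // x; rewrite divr_ge0//; exact: trans_ge0.
Qed.

Lemma mean_row s t u : mean (fun y => trans K s t u y / p y) = 1.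
Proof.
rewrite -[RHS](trans_sum s t u sK); apply: eq_bigr => y _.
by rewrite mul1r mulrC divfK// gt_eqF.
Qed.

Lemma row_decay s t u :
  let g := fun y => trans K s t u y / p y in t%:R * (dot p g g - 1) <= H.
Proof.
elim: t => [|t IH]; cbv zeta; first by rewrite mul0r ltW.
set g := fun y => trans K s t u y / p y in IH *.
have -> : (fun y => trans K s t.+1 u y / p y) = app (K (s + t).+1) g.
  apply/funext => y; rewrite /app trans_recr mulr_suml; apply: eq_bigr => z _.
  have := rK (s + t) z y; rewrite /g => e.
  have -> : K (s + t).+1 z y = p y * K (s + t).+1 y z / p z.
    by rewrite -e mulrAC divff ?mul1r// gt_eqF.
  by field; rewrite !gt_eqF.
have g1 : mean g = 1 by exact: mean_row.
apply: decay_step IH _.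
  by rewrite subr_ge0 -[X in X <= _](expr1n _ 2) -g1 sqr_mean_le.
apply: excess_step => // x; rewrite divr_ge0//; exact: trans_ge0.
Qed.

Lemma lazy_separation (T s : nat) u v : 2 * H <= T%:R ->
  p v / 2 <= trans K s (T + T) u v.
Proof.
move=> HT; rewrite trans_add.
set f := fun y => trans K s T u y / p y.
set g := fun y => trans K (s + T) T y v / p v.
have -> : \sum_y trans K s T u y * trans K (s + T) T y v = p v * dot p f g.
  rewrite /dot mulr_sumr; apply: eq_bigr => y _; rewrite /f /g.
  by field; rewrite !gt_eqF.
rewrite ler_wpM2l//.
have f1 : mean f = 1 by exact: mean_row.
have g1 : mean g = 1 by exact: mean_col.
have fd : T%:R * (dot p f f - 1) <= H by exact: row_decay.
have gd : T%:R * (dot p g g - 1) <= H by exact: col_decay.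
have T0 : 0 < T%:R :> R by apply: lt_le_trans HT; rewrite mulr_gt0.
have h1 := H_gt0.
have {}fd : dot p f f - 1 <= 1 / 2.
  by rewrite -(ler_pM2l T0); lra.
have {}gd : dot p g g - 1 <= 1 / 2.
  by rewrite -(ler_pM2l T0); lra.
pose one : V -> R := fun=> 1.
have := dot_ge0 (fun y => 1 * (1 * f y + 1 * g y) + (-2) * one y) p0.
rewrite !(dot_lin, dot_linl) (dotC p g f) (dotC p f one) (dotC p g one) -/(mean f) -/(mean g).
rewrite f1 g1.
have -> : dot p one one = 1.
  by rewrite -[RHS]p1; apply: eq_bigr => x _; rewrite !mulr1.
lra.
Qed.

End reversible_sequence.
End InhomogeneousChain.

(** * Several independent walks *)

Section MultipleWalks.
Variables (R : realType) (V : finType) (k : nat).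
Notation walkers := {ffun 'I_k -> V}.
Implicit Types (K : nat -> V -> V -> R) (x y : walkers) (U : {set V}).
Local Open Scope set_scope.

Definition remaining U x : {set V} := U :\: [set x i | i : 'I_k].

Definition joint (k0 : V -> V -> R) x y : R := \prod_i k0 (x i) (y i).

(* Probability that k independent walks started from x at time s have not
   covered U by time s + t. *)
Fixpoint uncov K (s t : nat) U x : R :=
  if t is t'.+1 then \sum_y joint (K s.+1) x y * uncov K s.+1 t' (remaining U x) y
  else (remaining U x != finset.set0)%:R.

Lemma sum_prod_walkers (F : 'I_k -> V -> R) :
  \sum_(y : walkers) \prod_i F i (y i) = \prod_i \sum_v F i v.
Proof. by rewrite bigA_distr_bigA. Qed.

Lemma joint_stochastic (k0 : V -> V -> R) : stochastic k0 ->
  (forall x y, 0 <= joint k0 x y) /\ (forall x, \sum_y joint k0 x y = 1).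
Proof.
move=> [k0_ge0 k01]; split=> [x y|x]; first exact: prodr_ge0.
by rewrite (sum_prod_walkers (fun i => k0 (x i))) big1.
Qed.

Lemma remaining_subset U x : remaining U x \subset U.
Proof. exact: finset.subsetDl. Qed.

Lemma remaining_set1 (w : V) x :
  remaining [set w] x = if [forall i, x i != w] then [set w] else finset.set0.
Proof.
apply/finset.setP => v; rewrite !inE; case: ifP => [/forallP xw|/negbT].
  rewrite !inE; case: eqVneq => [->|]; rewrite ?andbF// andbT.
  by apply/negP => /imsetP[i _ e]; have := xw i; rewrite -e eqxx.
rewrite negb_forall => /existsP[i]; rewrite negbK => /eqP xw.
rewrite inE; case: eqVneq => [->|]; rewrite ?andbF// andbT.
by apply/negbTE; rewrite negbK -xw; apply/imsetP; exists i.
Qed.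

Lemma uncov_set0 K s t x : uncov K s t finset.set0 x = 0.
Proof.
elim: t s x => [|t IH] s x /=; rewrite /remaining finset.set0D ?eqxx//.
by rewrite big1// => y _; rewrite IH mulr0.
Qed.

Section stochastic_steps.
Variable K : nat -> V -> V -> R.
Hypothesis sK : forall t, stochastic (K t.+1).

Let J0 s x y : 0 <= joint (K s.+1) x y.
Proof. by have [-> //] := joint_stochastic (sK s). Qed.

Let J1 s x : \sum_y joint (K s.+1) x y = 1.
Proof. by have [_ -> //] := joint_stochastic (sK s). Qed.

Lemma uncov_bounds s t U x : 0 <= uncov K s t U x <= 1.
Proof.
elim: t s U x => [|t IH] s U x /=; first by case: (_ != _); rewrite /= ?lexx ?ler01.
apply/andP; split.
  by apply: sumr_ge0 => y _; rewrite mulr_ge0//; case/andP: (IH s.+1 (remaining U x) y).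
rewrite -[leRHS](J1 s x); apply: ler_sum => y _.
by rewrite ler_piMr//; case/andP: (IH s.+1 (remaining U x) y).
Qed.

Lemma uncov_mono s t U U' x : U \subset U' -> uncov K s t U x <= uncov K s t U' x.
Proof.
elim: t s U U' x => [|t IH] s U U' x UU' /=.
  rewrite ler_nat; case: eqVneq => //= U0; rewrite lt0b.
  apply: contraNneq U0 => U0; rewrite -finset.subset0 -U0; exact: finset.setSD.
by apply: ler_sum => y _; rewrite ler_wpM2l// IH// finset.setSD.
Qed.

Lemma uncov_addl s a b U x (M : R) : (forall y, uncov K (s + a) b U y <= M) ->
  uncov K s (a + b) U x <= uncov K s a U x * M.
Proof.
elim: a s U x => [|a IH] s U x hM.
  rewrite add0n /=; case: eqVneq => U0 /=; last by rewrite mul1r -(addn0 s).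
  rewrite mul0r; case: b {hM} => [|b] /=; first by rewrite U0 eqxx.
  by rewrite big1// => y _; rewrite U0 uncov_set0 mulr0.
rewrite /= mulr_suml; apply: ler_sum => y _; rewrite -mulrA ler_wpM2l//.
apply: IH => z; apply: le_trans (hM z); rewrite addSnnS.
exact: uncov_mono (remaining_subset U x).
Qed.

Lemma uncov_forget s a b U x :
  uncov K s (a + b) U x <=
  \sum_(y : walkers) (\prod_i trans K s a (x i) (y i)) * uncov K (s + a) b U y.
Proof.
elim: a s x => [|a IH] s x.
  rewrite addn0 add0n (bigD1 x)//= [X in X * _]big1 ?mul1r; last first.
    by move=> i _; rewrite eqxx.
  rewrite lerDl; apply: sumr_ge0 => y _; apply: mulr_ge0.
    by apply: prodr_ge0 => i _; case: (_ == _) => /=.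
  by case/andP: (uncov_bounds s b U y).
rewrite /=.
apply: (@le_trans _ _ (\sum_z joint (K s.+1) x z * \sum_(y : walkers)
    (\prod_i trans K s.+1 a (z i) (y i)) * uncov K (s + a.+1) b U y)).
  apply: ler_sum => z _; rewrite ler_wpM2l//.
  apply: (le_trans (uncov_mono s.+1 (a + b) z (remaining_subset U x))).
  by rewrite -addSnnS.
rewrite (eq_bigr (fun z => \sum_(y : walkers) (joint (K s.+1) x z *
   (\prod_i trans K s.+1 a (z i) (y i))) * uncov K (s + a.+1) b U y)); last first.
  by move=> z _; rewrite mulr_sumr; apply: eq_bigr => y _; rewrite mulrA.
rewrite exchange_big/=; apply: ler_sum => y _.
rewrite -mulr_suml le_eqVlt; apply/orP; left; apply/eqP; congr (_ * _).
rewrite -(sum_prod_walkers (fun i v => K s.+1 (x i) v * trans K s.+1 a v (y i))).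
by apply: eq_bigr => z _; rewrite /joint -big_split.
Qed.

Lemma uncov_set1 s t (w : V) x : uncov K s t [set w] x = \prod_i miss K s t w (x i).
Proof.
elim: t s x => [|t IH] s x /=; rewrite remaining_set1; case: ifP => [/forallP xw|/negbT].
- rewrite big1; last by move=> i _; rewrite xw.
  by rewrite -card_gt0 cards1.
- rewrite negb_forall eqxx => /existsP[i]; rewrite negbK => /eqP xw.
  by rewrite (bigD1 i)//= xw eqxx mul0r.
- under eq_bigr do rewrite IH /joint -big_split/=.
  rewrite (sum_prod_walkers (fun i v => K s.+1 (x i) v * miss K s.+1 t w v)).
  by apply: eq_bigr => i _; rewrite /killed xw mul1r.
- rewrite negb_forall => /existsP[i]; rewrite negbK => /eqP xw.
  rewrite (bigD1 i)//= /killed xw eqxx !mul0r big1// => y _.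
  by rewrite uncov_set0 mulr0.
Qed.

Lemma uncov_union s t U x :
  uncov K s t U x <= \sum_(w in U) \prod_i miss K s t w (x i).
Proof.
under eq_bigr do rewrite -uncov_set1.
elim: t s U x => [|t IH] s U x /=.
  case: eqVneq => [_|/finset.set0Pn[w]] /=; first by apply: sumr_ge0 => w _; case: (_ != _).
  rewrite inE => /andP[wx wU]; rewrite (bigD1 w)//= -[leLHS]addr0 lerD//.
    suff -> : remaining [set w] x = [set w] by rewrite -card_gt0 cards1.
    by apply/finset.setDidPl; rewrite disjoints1.
  by apply: sumr_ge0 => v _; case: (_ != _).
rewrite exchange_big/=; apply: ler_sum => y _; rewrite -mulr_sumr ler_wpM2l//.
apply: (le_trans (IH s.+1 (remaining U x) y)).
rewrite [leRHS](big_setID [set v in U | v \notin [set x i | i : 'I_k]])/=.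
rewrite (_ : U :&: _ = remaining U x); last first.
  by apply/finset.setP => v; rewrite !inE; case: (v \in U); rewrite ?andbF ?andbT.
rewrite -[leLHS]addr0 lerD//; last first.
  by apply: sumr_ge0 => v _; case/andP: (uncov_bounds s.+1 t (remaining [set v] x) y).
apply: ler_sum => w; rewrite inE => /andP[wx wU].
suff -> : remaining [set w] x = [set w] by [].
by apply/finset.setDidPl; rewrite disjoints1.
Qed.

(* Writing trans = p/2 + nu with nu >= 0, each walker is independently stationary
   with probability 1/2, so with probability >= 1/2 at least half of them are. *)
Lemma uncov_epoch (p : V -> R) (r : R) s a b U x :
  (forall v, 0 <= p v) -> \sum_v p v = 1 ->
  (forall u v, p v / 2 <= trans K s a u v) -> 0 <= r <= 1 ->
  (forall w, dot p (fun=> 1) (miss K (s + a) b w) <= r) ->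
  (forall j, (k <= j.*2)%N -> #|U|%:R * r ^+ j <= 1 / 2) ->
  uncov K s (a + b) U x <= 3 / 4.
Proof.
move=> p0 p1 sep /andP[r0 r1] hr hU.
apply: (le_trans (uncov_forget s a b U x)).
pose m (i : 'I_k) (c : bool) (v : V) : R :=
  if c then p v / 2 else trans K s a (x i) v - p v / 2.
have m0 i c v : 0 <= m i c v.
  by case: c; rewrite /m ?subr_ge0//; rewrite divr_ge0.
have m1 i c : \sum_v m i c v = 2^-1.
  have hp : \sum_v p v / 2 = 2^-1 by rewrite -mulr_suml p1 mul1r.
  by case: c; rewrite /m // sumrB hp trans_sum//; lra.
have mE (y : walkers) : \prod_i trans K s a (x i) (y i) =
    \sum_(f : {ffun 'I_k -> bool}) \prod_i m i (f i) (y i).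
  rewrite -(bigA_distr_bigA (fun i c => m i c (y i))).
  by apply: eq_bigr => i _; rewrite big_bool /m /=; ring.
pose Phi (f : {ffun 'I_k -> bool}) : R :=
  \sum_(y : walkers) (\prod_i m i (f i) (y i)) * uncov K (s + a) b U y.
under eq_bigr do rewrite mE mulr_suml.
rewrite exchange_big/= -/(Phi _).
have P0 (f : {ffun _ -> _}) (y : walkers) : 0 <= \prod_i m i (f i) (y i) by exact: prodr_ge0.
have PhiA f : Phi f <= 2^-1 ^+ k.
  apply: (@le_trans _ _ (\sum_(y : walkers) \prod_i m i (f i) (y i))).
    by apply: ler_sum => y _; rewrite ler_piMr//; case/andP: (uncov_bounds (s + a) b U y).
  rewrite (sum_prod_walkers (fun i => m i (f i))) (eq_bigr (fun=> 2^-1)); last by move=> i _; exact: m1.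
  by rewrite prodr_const card_ord.
have PhiB f : Phi f <= 2^-1 ^+ k * (#|U|%:R * r ^+ #|[set i | f i]|).
  apply: (@le_trans _ _ (\sum_(w in U) \sum_(y : walkers) \prod_i (m i (f i) (y i) * miss K (s + a) b w (y i)))).
    rewrite exchange_big/=; apply: ler_sum => y _.
    apply: (le_trans (ler_wpM2l (P0 f y) (uncov_union (s + a) b U y))).
    rewrite mulr_sumr; apply: ler_sum => w _.
    by rewrite big_split.
  rewrite mulrCA mulr_natl -sumr_const; apply: ler_sum => w _.
  rewrite (sum_prod_walkers (fun i v => m i (f i) v * miss K (s + a) b w v)).
  apply: (@le_trans _ _ (\prod_(i < k) (2^-1 * (if f i then r else 1)))).
    apply: ler_prod => i _; apply/andP; split.
      by apply: sumr_ge0 => v _; rewrite mulr_ge0//; case/andP: (miss_bounds (s + a) b w v sK).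
    case: (f i).
      rewrite /m mulrC; apply: (@le_trans _ _ (dot p (fun=> 1) (miss K (s + a) b w) / 2)).
        by rewrite /dot mulr_suml; apply: ler_sum => v _; rewrite mul1r mulrAC.
      by rewrite ler_pM2r ?hr.
    rewrite mulr1 -(m1 i false); apply: ler_sum => v _.
    by rewrite ler_piMr//; case/andP: (miss_bounds (s + a) b w v sK).
  rewrite big_split/= prodr_const card_ord -big_mkcond/= prodr_const.
  by rewrite cardsE.
pose flip (f : {ffun 'I_k -> bool}) : {ffun 'I_k -> bool} := [ffun i => ~~ f i].
have flipK : involutive flip by move=> f; apply/ffunP => i; rewrite !ffunE negbK.
have pair (f : {ffun 'I_k -> bool}) : Phi f + Phi (flip f) <= 3 / 2 * 2^-1 ^+ k.
  have c0 : 0 <= 2^-1 ^+ k :> R by rewrite exprn_ge0// invr_ge0.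
  have half (g : {ffun 'I_k -> bool}) : (k <= #|[set i | g i]|.*2)%N -> Phi g <= 1 / 2 * 2^-1 ^+ k.
    move=> hg; apply: (le_trans (PhiB g)); rewrite mulrC ler_wpM2r//; exact: hU.
  have cc : (#|[set i | f i]| + #|[set i | flip f i]| = k)%N.
    rewrite -[RHS]card_ord -(cardsC [set i | f i]); congr (_ + _)%N.
    by apply: eq_card => i; rewrite !inE ffunE.
  have [hf|hf] := leqP k #|[set i | f i]|.*2.
    by have := half f hf; have := PhiA (flip f); lra.
  have hf' : (k <= #|[set i | flip f i]|.*2)%N by lia.
  by have := half _ hf'; have := PhiA f; lra.
have -> : \sum_f Phi f = (\sum_f (Phi f + Phi (flip f))) / 2.
  rewrite big_split/= [X in _ + X](_ : _ = \sum_f Phi f); last first.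
    by rewrite [RHS](reindex_inj (inv_inj flipK)).
  lra.
apply: (@le_trans _ _ ((\sum_(f : {ffun 'I_k -> bool}) 3 / 2 * 2^-1 ^+ k) / 2)).
  by rewrite ler_pM2r//; apply: ler_sum => f _; exact: pair.
rewrite sumr_const card_ffun card_bool card_ord -[X in X / _]mulr_natl natrX.
rewrite (_ : 2%:R ^+ k * (3 / 2 * 2^-1 ^+ k) = 3 / 2); first by lra.
by rewrite mulrCA -exprMn divff ?expr1n ?mulr1.
Qed.

Lemma sum_uncov_le (L : nat) U x (n : nat) : (0 < L)%N ->
  (forall s y, uncov K s L U y <= 3 / 4) ->
  \sum_(0 <= t < n) uncov K 0 t U x <= 4 * L%:R.
Proof.
move=> L0 hL.
have geo j s r y : uncov K s (j * L + r) U y <= (3 / 4) ^+ j.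
  elim: j s y => [|j IH] s y; first by rewrite expr0; case/andP: (uncov_bounds s (0 * L + r) U y).
  rewrite mulSn -addnA exprS.
  apply: (le_trans (@uncov_addl s L _ U y _ (IH (s + L)%N))).
  by rewrite ler_wpM2r// exprn_ge0.
have blocks j : \sum_(0 <= t < j * L) uncov K 0 t U x <= 4 * L%:R * (1 - (3 / 4) ^+ j).
  elim: j => [|j IH]; first by rewrite mul0n big_geq// expr0 subrr mulr0.
  rewrite mulSnr (@big_cat_nat _ _ _ (j * L)%N)/= ?leq_addr//.
  rewrite -{2}(add0n (j * L)%N) big_addn addnC addnK.
  have : \sum_(0 <= i < L) uncov K 0 (i + j * L) U x <= L%:R * (3 / 4) ^+ j.
    apply: (@le_trans _ _ (\sum_(0 <= i < L) (3 / 4) ^+ j)).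
      by apply: ler_sum => i _; rewrite addnC geo.
    by rewrite sumr_const_nat subn0 -[leLHS]mulr_natl.
  by rewrite exprS; move: IH; lra.
apply: (@le_trans _ _ (\sum_(0 <= t < n * L) uncov K 0 t U x)).
  rewrite [leRHS](@big_cat_nat _ _ _ n)/= ?leq_pmulr// lerDl.
  by apply: sumr_ge0 => t _; case/andP: (uncov_bounds 0 t U x).
by apply: (le_trans (blocks n)); rewrite ler_piMr ?mulr_ge0// gerBl exprn_ge0.
Qed.

End stochastic_steps.
End MultipleWalks.

(** * Walks on a probability space *)

Section FiniteWalk.
Variables (R : realType) (d : measure_display) (T : measurableType d).
Variables (Pr : probability T R) (S : finType).

Definition history (Y : nat -> T -> S) (t : nat) (h : nat -> S) : set T :=
  [set o | forall s, (s <= t)%N -> Y s o = h s].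

Definition markov (Q : nat -> S -> S -> R) (Y : nat -> T -> S) :=
  (forall t v, measurable [set o | Y t o = v]) /\
  (forall t h v, Pr [set o | history Y t h o /\ Y t.+1 o = v] =
     (Pr (history Y t h) * (Q t.+1 (h t) v)%:E)%E).

Definition extend t (h : nat -> S) (v : S) (r : nat) : S := if (r <= t)%N then h r else v.

Lemma extend_last t h v : extend t h v t.+1 = v.
Proof. by rewrite /extend ltnn. Qed.

Lemma history_extend Y t h v :
  history Y t.+1 (extend t h v) = [set o | history Y t h o /\ Y t.+1 o = v].
Proof.
apply/seteqP; split=> o /=.
  move=> ho; split; last by rewrite ho// extend_last.
  by move=> r rt; rewrite ho ?leqW// /extend rt.
move=> [ho hv] r; rewrite leq_eqVlt => /orP[/eqP ->|]; first by rewrite hv extend_last.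
by rewrite ltnS => rt; rewrite ho// /extend rt.
Qed.

Lemma measurable_preimage_fin (Z : T -> S) (B : set S) :
  (forall v, measurable [set o | Z o = v]) -> measurable [set o | B (Z o)].
Proof.
move=> mZ; have -> : [set o | B (Z o)] = \bigcup_(v in B) [set o | Z o = v].
  by apply/seteqP; split=> o /=; [by move=> Bo; exists (Z o)|by move=> [v Bv ->]].
by apply: fin_bigcup_measurable => //; exact: finite_finset.
Qed.

Lemma probability_total (Z : T -> S) (E : set T) : measurable E ->
  (forall v, measurable [set o | Z o = v]) ->
  Pr E = (\sum_v Pr (E `&` [set o | Z o = v]))%E.
Proof.
move=> mE mZ.
have part (r : seq S) : uniq r ->
    Pr (E `&` [set o | Z o \in r]) = (\sum_(v <- r) Pr (E `&` [set o | Z o = v]))%E.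
  elim: r => [_|v r IH /andP[vr ur]].
    by rewrite big_nil (_ : E `&` _ = set0) ?measure0// -subset0 => o [].
  rewrite big_cons -IH// -measureU.
  - congr (Pr _); apply/seteqP; split=> o /=.
      by rewrite inE => -[Eo /orP[/eqP|]]; [left|right].
    by move=> [[Eo ->]|[Eo zr]]; rewrite inE ?eqxx// zr orbT.
  - exact: measurableI.
  - by apply: measurableI => //; exact: (measurable_preimage_fin [set` r] mZ).
  - by rewrite -subset0 => o [[_ /= ->] [_]] /=; rewrite (negbTE vr).
rewrite -[LHS](_ : Pr (E `&` [set o | Z o \in index_enum S]) = _); last first.
  by congr (Pr _); apply/seteqP; split=> o /=; [by case|by rewrite mem_index_enum].
by rewrite part// index_enum_uniq.
Qed.

Lemma measurable_history Y t h :
  (forall t v, measurable [set o | Y t o = v]) -> measurable (history Y t h).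
Proof.
move=> mY; have -> : history Y t h = \bigcap_(s in [set s | (s <= t)%N]) [set o | Y s o = h s].
  by apply/seteqP; split=> o /= ho s; exact: ho.
by apply: bigcap_measurableType.
Qed.

End FiniteWalk.

Section JointWalk.
Variables (R : realType) (V : finType) (k : nat).
Variables (d : measure_display) (T : measurableType d) (Pr : probability T R).
Notation walkers := {ffun 'I_k -> V}.
Variables (K : nat -> V -> V -> R) (Y : nat -> T -> walkers).
Hypothesis mY : markov Pr (fun t => joint (K t)) Y.

Definition avoiding (U : {set V}) (s t : nat) : set T :=
  [set o | exists2 w, w \in U & forall r i, (s <= r <= s + t)%N -> Y r o i <> w].

Lemma measurable_avoiding U s t : measurable (avoiding U s t).
Proof.
have -> : avoiding U s t = \bigcup_(w in [set` U])
    \bigcap_(r in [set r | (s <= r <= s + t)%N]) [set o | forall i, Y r o i <> w].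
  apply/seteqP; split=> o.
    by move=> [w wU h]; exists w => // r /= hr i; exact: h.
  by move=> [w /= wU h]; exists w => // r i hr; exact: h.
apply: fin_bigcup_measurable => [|w _]; first exact: finite_finset.
apply: bigcap_measurableType => r _.
exact: (measurable_preimage_fin [set y : walkers | forall i, y i <> w] (mY.1 r)).
Qed.

Lemma in_remaining (U : {set V}) (x : walkers) w :
  (w \in remaining U x) <-> (w \in U /\ forall i, x i <> w).
Proof.
rewrite !inE; split=> [/andP[wx ->]|[-> h]].
  split=> // i e; move/negP: wx; apply; apply/imsetP; by exists i.
by rewrite andbT; apply/negP => /imsetP[i _ e]; exact: (h i).
Qed.

Lemma prob_avoiding U s t h :
  Pr (history Y s h `&` avoiding U s t) =
  (Pr (history Y s h) * (uncov K s t U (h s))%:E)%E.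
Proof.
elim: t s U h => [|t IH] s U h /=.
  case: eqVneq => [U0|/finset.set0Pn[w]] /=.
    rewrite mule0 (_ : _ `&` _ = set0) ?measure0// -subset0 => o [ho [w wU hw]].
    have : w \in remaining U (h s).
      by apply/in_remaining; split=> // i; rewrite -ho//; apply: hw; rewrite addn0 leqnn.
    by rewrite U0 inE.
  move=> /in_remaining[wU hw]; rewrite mule1; congr (Pr _).
  apply/seteqP; split=> o; [by case|move=> ho]; split=> //; exists w => // r i.
  by rewrite addn0 -eqn_leq => /eqP <-; rewrite ho.
rewrite (@probability_total _ _ _ Pr _ (Y s.+1)); last 2 first.
- by apply: measurableI; [exact: (measurable_history _ _ mY.1)|exact: measurable_avoiding].
- exact: mY.1.
have fin : Pr (history Y s h) = (fine (Pr (history Y s h)))%:E.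
  by rewrite fineK// fin_num_measure//; exact: (measurable_history _ _ mY.1).
rewrite fin -EFinM mulr_sumr -sumEFin; apply: eq_bigr => y _.
have -> : history Y s h `&` avoiding U s t.+1 `&` [set o | Y s.+1 o = y] =
    history Y s.+1 (extend s h y) `&` avoiding (remaining U (h s)) s.+1 t.
  rewrite history_extend; apply/seteqP; split=> o.
    move=> [[ho [w wU hw]] /= hy]; split=> //; exists w.
      apply/in_remaining; split=> // i; rewrite -ho//; apply: hw.
      by rewrite leqnn leq_addr.
    by move=> r i /andP[sr rt]; apply: hw; rewrite ltnW// -addSnnS.
  move=> [[ho hy] [w /in_remaining[wU hx] hw]]; split=> //; split=> //.
  exists w => // r i; rewrite leq_eqVlt => /andP[/orP[/eqP <- _|sr rt]].
    by rewrite ho.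
  by apply: hw; rewrite sr addSnnS.
by rewrite IH history_extend mY.2 fin -!EFinM extend_last mulrA.
Qed.

End JointWalk.

Section InfTime.
Variables (R : realType).
Local Open Scope ereal_scope.

Lemma inf_time_attained (A : set nat) :
  (inf_time R A = +oo /\ A = set0) \/
  exists m, [/\ A m, (forall t, A t -> (m <= t)%N) & inf_time R A = (m%:R)%:E].
Proof.
have [[t At]|A0] := pselect (exists t, A t); last first.
  have {}A0 : A = set0 by rewrite -subset0 => t At; apply: A0; exists t.
  by left; split=> //; apply/ereal_inf_pinfty => y [t]; rewrite A0.
have ex : exists t, `[< A t >] by exists t; apply/asboolP.
case: (ex_minnP ex) => m /asboolP Am minm; right; exists m.
have {}minm s : A s -> (m <= s)%N by move=> As; apply: minm; apply/asboolP.
split=> //; apply/eqP; rewrite eq_le; apply/andP; split.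
  by apply: ereal_inf_lbound; exists m.
by apply: le_ereal_inf_tmp => _ [s /minm ms <-]; rewrite lee_fin ler_nat.
Qed.

Lemma inf_time_series (A : set nat) : (forall s t, (s <= t)%N -> A s -> A t) ->
  inf_time R A = \sum_(t <oo) (\1_(~` A) t)%:E.
Proof.
move=> up; have i0 t : 0 <= (\1_(~` A) t)%:E :> \bar R by rewrite lee_fin.
have [[-> A0]|[m [Am minm ->]]] := inf_time_attained A.
  apply/esym/eqyP => M M0; pose n := Num.truncn M.
  apply: (@le_trans _ _ (\sum_(0 <= i < n.+1) (\1_(~` A) i)%:E)); last exact: nneseries_lim_ge.
  rewrite sumEFin lee_fin (eq_bigr (fun=> 1%R)); last first.
    by move=> t _; rewrite indicE mem_set// A0.
  by rewrite sumr_const_nat subn0 ltW// truncnS_gt.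
rewrite (nneseries_split 0 m)// add0n eseries0; last first.
  by move=> i mi _; rewrite indicE memNset//= => /(_ (up _ _ mi Am)).
rewrite adde0 sumEFin (eq_big_nat _ _ (F2 := fun=> 1%R)); last first.
  by move=> i /andP[_ im]; rewrite indicE mem_set// => /minm; rewrite leqNgt im.
by rewrite sumr_const_nat subn0.
Qed.

Lemma cond_expectation_inf_time (d : measure_display) (T : measurableType d)
    (Pr : probability T R) (E : set T) (A : T -> set nat) :
  measurable E -> (forall t, measurable [set o | ~ A o t]) ->
  (forall o s t, (s <= t)%N -> A o s -> A o t) ->
  cond_expectation Pr E (fun o => inf_time R (A o)) =
  (fine (Pr E))^-1%:E * \sum_(t <oo) Pr (E `&` [set o | ~ A o t]).
Proof.
move=> mE mA up; congr (_ * _).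
transitivity (\int[Pr]_(o in E) \sum_(t <oo) (\1_[set o | ~ A o t] o)%:E).
  apply: eq_integral => o _; rewrite inf_time_series; last exact: up.
  by apply: eq_eseriesr => t _; rewrite !indicE.
rewrite integral_nneseries//; last first.
  by move=> n; apply/measurable_realfun.measurable_EFinP; exact: measurable_realfun.measurable_indic.
by apply: eq_eseriesr => t _; rewrite integral_indic// setIC.
Qed.

End InfTime.

Section RandomWalks.
Variables (R : realType) (V : finType) (k : nat) (P : nat -> 'M[R]_#|V|).
Variables (d : measure_display) (T : measurableType d) (Pr : probability T R).
Variables (X : 'I_k -> nat -> T -> V).
Hypothesis wX : random_walks P Pr X.

Let Y t o : {ffun 'I_k -> V} := [ffun i => X i t o].

Lemma independent_histories t (h : nat -> {ffun 'I_k -> V}) :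
  Pr (history Y t h) = (\prod_(i < k) Pr [set o | forall s, (s <= t)%N -> X i s o = h s i])%E.
Proof.
pose A i : set (t.+1.-tuple V) := [set u | forall s : 'I_t.+1, tnth u s = h s i].
have AE i o : A i [tuple X i s o | s < t.+1] <-> forall s, (s <= t)%N -> X i s o = h s i.
  split=> [a s st|a s]; last by rewrite tnth_mktuple a// -ltnS.
  by have := a (Ordinal (st : (s < t.+1)%N)); rewrite tnth_mktuple.
have := wX.2 t A; rewrite (_ : [set o | forall i, _] = history Y t h); last first.
  apply/seteqP; split=> o /= ho.
    by move=> s st; apply/ffunP => i; rewrite ffunE; have /AE := ho i; exact.
  by move=> i; apply/AE => s st; rewrite -ho// ffunE.
move=> ->; apply: eq_bigr => i _; congr (Pr _).
by apply/seteqP; split=> o /AE.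
Qed.

Lemma joint_markov : markov Pr (fun t => joint (entry (P t))) Y.
Proof.
have mX i t v : measurable [set o | X i t o = v] by have [+ _] := wX.1 i; apply.
split=> [t v|t h v].
  have -> : [set o | Y t o = v] = \bigcap_(i in [set: 'I_k]) [set o | X i t o = v i].
    apply/seteqP; split=> o /= ho; first by move=> i _; rewrite -ho ffunE.
    by apply/ffunP => i; rewrite ffunE ho.
  by apply: fin_bigcap_measurable => // i _; exact: mX.
rewrite -history_extend !independent_histories /joint -prodEFin -big_split/=.
apply: eq_bigr => i _; have [_ /(_ t (fun s => h s i) (v i)) <-] := wX.1 i.
rewrite -(history_extend (X i) t (fun s => h s i)); congr (Pr _).
by apply/seteqP; split=> o ho s /ho ->; rewrite /extend; case: ifP.
Qed.

Variable (x : {ffun 'I_k -> V}).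
Let start := [set o | forall i, X i 0%N o = x i].
Hypothesis start_gt0 : (0 < Pr start)%E.

Lemma cond_expectation_uncov (U : {set V}) (A : T -> set nat) :
  (forall o t, A o t <-> forall w, w \in U -> visited (fun i t => X i t o) t w) ->
  cond_expectation Pr start (fun o => inf_time R (A o)) =
  (\sum_(t <oo) (uncov (fun t => entry (P t)) 0 t U x)%:E)%E.
Proof.
move=> AE.
have startE : start = history Y 0 (fun=> x).
  apply/seteqP; split=> o /= ho.
    by move=> s; rewrite leqn0 => /eqP ->; apply/ffunP => i; rewrite ffunE ho.
  by move=> i; rewrite -(ho 0%N)// ffunE.
have avE t : [set o | ~ A o t] = avoiding Y U 0 t.
  apply/seteqP; split=> o /=.
    move=> nA; apply: contrapT => nav; apply: nA; apply/AE => w wU.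
    apply: contrapT => nv; apply: nav; exists w => // r i /andP[_ rt].
    by rewrite ffunE => e; apply: nv; exists i, r.
  move=> [w wU hw] /AE /(_ w wU)[i [s [st e]]].
  by apply: (hw s i); rewrite ?ffunE.
have mst : measurable start by rewrite startE; exact: (measurable_history _ _ joint_markov.1).
rewrite cond_expectation_inf_time//.
- have fin : Pr start = (fine (Pr start))%:E by rewrite fineK// fin_num_measure.
  have f0 : (0 < fine (Pr start))%R by rewrite -lte_fin -fin.
  rewrite -nneseriesZl; last by move=> t _; exact: measure_ge0.
  apply: eq_eseriesr => t _.
  rewrite avE {2}startE (prob_avoiding joint_markov) -startE fin -!EFinM.
  by rewrite mulrA mulVf ?mul1r// gt_eqF.
- by move=> t; rewrite avE; exact: (measurable_avoiding joint_markov).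
- move=> o s t st /AE As; apply/AE => w /As[i [r [rs e]]].
  by exists i, r; split=> //; exact: leq_trans st.
Qed.

End RandomWalks.

Lemma cond_values_tau_hit (R : realType) (V : finType) (k : nat)
    (P : nat -> 'M[R]_#|V|) (x : 'I_k -> V) (w : V) (e : \bar R) :
  cond_values P x (fun y => tau_hit R y w) e ->
  e = (\sum_(t <oo) (uncov (fun t => entry (P t)) 0 t [set w]%SET [ffun i => x i])%:E)%E.
Proof.
move=> [d [T [Pr [X [wX x0 ->]]]]].
have xE : [set o | forall i, X i 0%N o = x i] =
    [set o | forall i, X i 0%N o = [ffun i => x i] i].
  by apply/seteqP; split=> o /= ho i; have := ho i; rewrite ffunE.
rewrite xE in x0 *; apply: (cond_expectation_uncov wX x0 (A := fun o => _)) => o t /=.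
split=> [vw v|]; last by apply; rewrite inE.
by rewrite inE => /eqP ->.
Qed.

Lemma cond_values_tau_cov (R : realType) (V : finType) (k : nat)
    (P : nat -> 'M[R]_#|V|) (x : 'I_k -> V) (e : \bar R) :
  cond_values P x (fun y => tau_cov R y) e ->
  e = (\sum_(t <oo) (uncov (fun t => entry (P t)) 0 t [set: V]%SET [ffun i => x i])%:E)%E.
Proof.
move=> [d [T [Pr [X [wX x0 ->]]]]].
have xE : [set o | forall i, X i 0%N o = x i] =
    [set o | forall i, X i 0%N o = [ffun i => x i] i].
  by apply/seteqP; split=> o /= ho i; have := ho i; rewrite ffunE.
rewrite xE in x0 *; apply: (cond_expectation_uncov wX x0 (A := fun o => _)) => o t /=.
split=> [-> //|h]; apply/seteqP; split=> // v _; apply: h; exact: finset.in_setT.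
Qed.

(* A Markov chain realised on [0, 1) with Lebesgue measure: each history owns a
   half-open interval, which is subdivided among the possible next states in
   proportion to the transition probabilities. *)
Section Realisation.
Variables (R : realType) (V : finType) (K : V -> V -> R) (x0 : V).
Hypothesis sK : stochastic K.

Definition cdf (u : V) (j : nat) : R := \sum_(v | (enum_rank v < j)%N) K u v.

Definition cell (u : V) (a l : R) (v : V) (z : R) : bool :=
  a + l * cdf u (enum_rank v) <= z < a + l * cdf u (enum_rank v).+1.

Definition next_state (z : R) (c : V * R * R) : V * R * R :=
  let: (u, a, l) := c in
  if [pick v | cell u a l v z] is Some v
  then (v, a + l * cdf u (enum_rank v), l * K u v) else c.

Definition clip (z : R) : R := if 0 <= z < 1 then z else 0.

Definition state (t : nat) (z : R) : V * R * R := iter t (next_state z) (x0, 0, 1).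

Definition chain (t : nat) (z : R) : V := (state t (clip z)).1.1.

Fixpoint itv_lo (h : nat -> V) (t : nat) : R :=
  if t is t'.+1 then itv_lo h t' + itv_len h t' * cdf (h t') (enum_rank (h t)) else 0
with itv_len (h : nat -> V) (t : nat) : R :=
  if t is t'.+1 then itv_len h t' * K (h t') (h t) else 1.

Lemma cdfS u v : cdf u (enum_rank v).+1 = cdf u (enum_rank v) + K u v.
Proof.
rewrite /cdf (bigD1 v)//= addrC; congr (_ + _); apply: eq_bigl => w.
by rewrite ltnS [RHS]ltn_neqAle andbC -(inj_eq enum_rank_inj).
Qed.

Lemma cdf_mono u : {homo cdf u : i j / (i <= j)%N >-> i <= j}.
Proof.
move=> i j ij; rewrite /cdf [leRHS](bigID (fun v => (enum_rank v < i)%N))/=.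
rewrite -[leLHS]addr0 lerD//; last by apply: sumr_ge0 => v _; exact: sK.1.
rewrite le_eqVlt; apply/orP; left; apply/eqP; apply: eq_bigl => v.
by apply/esym/andb_idl => vi; exact: leq_trans ij.
Qed.

Lemma cdf0 u : cdf u 0 = 0.
Proof. by rewrite /cdf big_pred0. Qed.

Lemma cdf_card u : cdf u #|V| = 1.
Proof. by rewrite -[RHS](sK.2 u); apply: eq_bigl => v; rewrite ltn_ord. Qed.

Lemma cell_inj u a l z v v' : 0 <= l -> cell u a l v z -> cell u a l v' z -> v = v'.
Proof.
move=> l0.
have lt w w' : (enum_rank w < enum_rank w')%N -> cell u a l w z -> cell u a l w' z -> False.
  move=> ww /andP[_ h1] /andP[h2 _].
  have : a + l * cdf u (enum_rank w).+1 <= a + l * cdf u (enum_rank w').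
    by rewrite lerD2l ler_wpM2l// cdf_mono.
  by move=> h3; have := le_lt_trans (le_trans h3 h2) h1; rewrite ltxx.
move=> h h'; case: (ltngtP (enum_rank v) (enum_rank v')) => [vv|vv|/val_inj/enum_rank_inj//].
- by case: (lt _ _ vv).
- by case: (lt _ _ vv).
Qed.

Lemma cell_cover u a l z : a <= z < a + l -> exists v, cell u a l v z.
Proof.
move=> /andP[az zl].
have V0 : (0 < #|V|)%N by apply/card_gt0P; exists u.
have ex : exists j, z < a + l * cdf u j.+1.
  by exists #|V|.-1; rewrite prednK// cdf_card mulr1.
case: (ex_minnP ex) => j zj minj.
have jV : (j < #|V|)%N.
  rewrite -(prednK V0) ltnS; apply: minj.
  by rewrite prednK// cdf_card mulr1.
exists (enum_val (Ordinal jV)); rewrite /cell enum_valK/= zj andbT.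
case: j zj minj jV => [|j] zj minj jV; first by rewrite cdf0 mulr0 addr0.
by rewrite leNgt; apply/negP => /minj; rewrite ltnn.
Qed.

Lemma itv_len_ge0 h t : 0 <= itv_len h t.
Proof. by elim: t => [|t IH] /=; rewrite ?ler01// mulr_ge0// sK.1. Qed.

Lemma itv_nested h t :
  itv_lo h t <= itv_lo h t.+1 /\
  itv_lo h t.+1 + itv_len h t.+1 <= itv_lo h t + itv_len h t.
Proof.
have l0 := itv_len_ge0 h t; split=> /=.
  by rewrite lerDl mulr_ge0// -(cdf0 (h t)) cdf_mono.
rewrite -addrA -mulrDr -cdfS lerD2l ler_piMr// -(cdf_card (h t)).
by rewrite cdf_mono// ltn_ord.
Qed.

Lemma itv_bounds h t : 0 <= itv_lo h t /\ itv_lo h t + itv_len h t <= 1.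
Proof.
elim: t => [|t [IH1 IH2]]; first by rewrite /= add0r.
by have [h1 h2] := itv_nested h t; split; [exact: le_trans h1|exact: le_trans IH2].
Qed.

Lemma itv_ext h h' t : (forall s, (s <= t)%N -> h s = h' s) ->
  itv_len h t = itv_len h' t.
Proof.
elim: t => //= t IH hh; rewrite !hh// IH// => s st; apply: hh; exact: leqW.
Qed.

Lemma itv_cell h t z :
  cell (h t) (itv_lo h t) (itv_len h t) (h t.+1) z =
  (itv_lo h t.+1 <= z < itv_lo h t.+1 + itv_len h t.+1).
Proof. by rewrite /cell cdfS mulrDr addrA. Qed.

Lemma state_itv h t z : h 0%N = x0 -> 0 <= z < 1 ->
  (itv_lo h t <= z < itv_lo h t + itv_len h t ->
    state t z = (h t, itv_lo h t, itv_len h t) /\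
    forall s, (s <= t)%N -> (state s z).1.1 = h s) /\
  ((forall s, (s <= t)%N -> (state s z).1.1 = h s) ->
    itv_lo h t <= z < itv_lo h t + itv_len h t).
Proof.
move=> h0 z01; elim: t => [|t [IH1 IH2]].
  rewrite /= add0r /state /= h0; split=> // _; split=> // s.
  by rewrite leqn0 => /eqP ->; rewrite h0.
have l0 := itv_len_ge0 h t.
split=> [zt|hs].
  have [n1 n2] := itv_nested h t.
  have zt' : itv_lo h t <= z < itv_lo h t + itv_len h t.
    by case/andP: zt => a b; rewrite (le_trans n1 a) (lt_le_trans b n2).
  have [st ht] := IH1 zt'.
  have stS : state t.+1 z = (h t.+1, itv_lo h t.+1, itv_len h t.+1).
    rewrite /state iterS -/(state t z) st /next_state.
    case: pickP => [v cv|/(_ (h t.+1))]; last by rewrite itv_cell zt.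
    by rewrite (cell_inj l0 cv _ (v' := h t.+1)) ?itv_cell.
  split=> // s; rewrite leq_eqVlt => /orP[/eqP ->|]; first by rewrite stS.
  exact: ht.
have zt' := IH2 (fun s st => hs s (leqW st)).
have [st _] := IH1 zt'.
have := hs t.+1 (leqnn _).
rewrite /state iterS -/(state t z) st /next_state.
case: pickP => [v cv /= vh|]; first by rewrite -itv_cell -vh.
by have [v cv] := cell_cover (h t) zt' => /(_ v); rewrite cv.
Qed.

Local Notation mu := (uniform_prob (@ltr01 R)).
Let T := measurableTypeR R.
Let chainT : nat -> T -> V := chain.

Let unit_itv : set T := [set` `[0%R, 1%R[].

Lemma uniform_prob_itv (a l : R) : 0 <= a -> 0 <= l -> a + l <= 1 ->
  mu [set` `[a, (a + l)%R[] = l%:E.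
Proof.
move=> a0 l0 al; rewrite /uniform_prob integral_uniform_pdf setIidl; last first.
  move=> z /=; rewrite !in_itv/= => /andP[az zl].
  by rewrite (le_trans a0 az) (ltW (lt_le_trans zl al)).
rewrite (eq_integral (fun=> 1%:E)); last first.
  move=> z; rewrite inE/= in_itv/= /uniform_pdf => /andP[az zl].
  by rewrite (le_trans a0 az) (ltW (lt_le_trans zl al))/= subr0 invr1.
rewrite integral_cst//= mul1e lebesgue_measure_itv/= lte_fin ltrDl.
case: ltgtP l0 => // [_ _|<- _]; last by [].
by rewrite -EFinB addrAC subrr add0r.
Qed.

Lemma prob_unit_itv (E : set T) : measurable E -> mu E = mu (E `&` unit_itv).
Proof.
move=> mE; have mI : measurable unit_itv by exact: measurable_itv.
have I1 : mu unit_itv = 1%E.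
  by have := @uniform_prob_itv 0 1 (lexx _) ler01; rewrite add0r; exact.
have C0 : mu (~` unit_itv) = 0%E by rewrite probability_setC// [X in (_ - X)%E](_ : _ = 1%E) ?subee.
rewrite -{1}(setIT E) -(setUv unit_itv) setIUr measureU.
- rewrite [X in (_ + X)%E](_ : _ = 0%E) ?adde0//.
  apply/eqP; rewrite eq_le measure_ge0 andbT -C0 le_measure ?inE//.
  + by apply: measurableI => //; exact: measurableC.
  + exact: measurableC.
- exact: measurableI.
- by apply: measurableI => //; exact: measurableC.
- by rewrite setIACA setICr setI0.
Qed.

Lemma chain_history_unit t h : h 0%N = x0 ->
  history chainT t h `&` unit_itv = [set` `[itv_lo h t, (itv_lo h t + itv_len h t)%R[].
Proof.
move=> h0; have [lo hi] := itv_bounds h t.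
have clipE z : 0 <= z < 1 -> clip z = z by rewrite /clip => ->.
apply/seteqP; split=> z /=; rewrite !in_itv/=.
  move=> [hz z01]; apply: (proj2 (state_itv t h0 z01)) => s st.
  by rewrite -(hz s st) /chainT /chain clipE.
move=> /[dup] hz /andP[az zl].
have z01 : 0 <= z < 1 by rewrite (le_trans lo az) (lt_le_trans zl hi).
split=> // s st; rewrite /chainT /chain clipE//.
exact: (proj2 (proj1 (state_itv t h0 z01) hz)).
Qed.

Lemma measurable_chain_history t h : measurable (history chainT t h).
Proof.
have [h0|h0] := eqVneq (h 0%N) x0; last first.
  rewrite (_ : history _ _ _ = set0) // -subset0 => z /(_ 0%N (leq0n _)) e.
  by move/eqP: h0; apply; rewrite -e.
rewrite -[history _ _ _]setIT -(setUv unit_itv) setIUr chain_history_unit//.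
apply: measurableU; first exact: measurable_itv.
have mI : measurable (~` unit_itv) by apply: measurableC; exact: measurable_itv.
have out z : ~ unit_itv z -> clip z = 0.
  by rewrite /unit_itv /= in_itv /clip /=; case: ifP.
have [hz|hz] := pselect (forall s, (s <= t)%N -> (state s 0).1.1 = h s).
  rewrite (_ : _ `&` _ = ~` unit_itv)//; apply/seteqP; split=> z; first by case.
  by move=> nz; split=> // s st; rewrite /chainT /chain out// hz.
rewrite (_ : _ `&` _ = set0) // -subset0 => z [ht nz]; apply: hz => s st.
by rewrite -ht// /chainT /chain out.
Qed.

Lemma prob_chain_history t h : h 0%N = x0 -> mu (history chainT t h) = (itv_len h t)%:E.
Proof.
move=> h0; have [lo hi] := itv_bounds h t.
rewrite prob_unit_itv; last exact: measurable_chain_history.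
by rewrite chain_history_unit// uniform_prob_itv// itv_len_ge0.
Qed.

Lemma measurable_chain t v : measurable [set z : T | chainT t z = v].
Proof.
have -> : [set z : T | chainT t z = v] =
    \bigcup_(f in [set f : {ffun 'I_t.+1 -> V} | f ord_max = v])
      history chainT t (fun s => f (inord s)).
  apply/seteqP; split=> z /=.
    move=> zv; exists [ffun s : 'I_t.+1 => chainT s z]; first by rewrite /= ffunE.
    by move=> s st; rewrite ffunE inordK.
  by move=> [f /= fv /(_ t (leqnn _)) ->]; rewrite -fv; congr (f _); apply/val_inj; rewrite /= inordK.
apply: fin_bigcup_measurable => [|f _]; first exact: finite_finset.
exact: measurable_chain_history.
Qed.

Lemma chain_markov t (h : nat -> V) v :
  mu [set z | (forall s, (s <= t)%N -> chainT s z = h s) /\ chainT t.+1 z = v] =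
  (mu [set z | forall s, (s <= t)%N -> chainT s z = h s] * (K (h t) v)%:E)%E.
Proof.
rewrite -(history_extend chainT t h v).
rewrite -/(history chainT t h).
have [h0|h0] := eqVneq (h 0%N) x0; last first.
  have e r g : (g 0%N = h 0%N) -> history chainT r g = set0.
    move=> gh; rewrite -subset0 => z /(_ 0%N (leq0n _)) e.
    by move/eqP: h0; apply; rewrite -gh -e.
  by rewrite !e// !measure0 mul0e.
rewrite !prob_chain_history// -EFinM /= extend_last /extend leqnn; congr (_ * _)%:E.
by apply: itv_ext => s st; rewrite st.
Qed.

End Realisation.

Lemma cond_values_inhabited (R : realType) (V : finType) (P : 'M[R]_#|V|)
    (x : V) (f : ('I_1 -> nat -> V) -> \bar R) :
  transition_matrix P -> exists e, cond_values (fun=> P) (fun=> x) f e.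
Proof.
move=> [P01 P1].
have sK : stochastic (entry P) by split=> // u v; case/andP: (P01 u v).
pose X (i : 'I_1) t (z : measurableTypeR R) := chain (entry P) x t z.
eexists; exists _, (measurableTypeR R), (uniform_prob (@ltr01 R)), X; split; last by [].
- split=> [i|t A].
    split=> [t v|t h v]; first exact: measurable_chain.
    exact: chain_markov.
  rewrite big_ord1; congr (uniform_prob _ _); apply/seteqP; split=> z /=; first exact.
  by move=> Az i; rewrite (ord1 i).
- rewrite (_ : [set o | _] = setT); first by rewrite probability_setT.
  by apply/seteqP; split.
Qed.

(** * Bounds in terms of the maximal hitting time *)

Section PotentialExistence.
Variables (R : realType) (V : finType) (k0 : V -> V -> R) (H : R) (w : V).
Hypothesis sk0 : stochastic k0.
Hypothesis bounded : forall n x, \sum_(0 <= j < n) miss (fun=> k0) 0 j w x <= H.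

Lemma miss_const s t x : miss (fun=> k0) s t w x = miss (fun=> k0) 0 t w x.
Proof.
elim: t s x => //= t IH s x; rewrite /killed /app; congr (_ * _).
by apply: eq_bigr => y _; rewrite IH [in RHS]IH.
Qed.

(* h x is the expected hitting time of w, the sum of the tails P_x(tau_w > j). *)
Lemma hit_potential_exists : exists h, hit_potential H k0 w h.
Proof.
pose S x n := \sum_(0 <= j < n) miss (fun=> k0) 0 j w x.
have m0 j x : 0 <= miss (fun=> k0) 0 j w x.
  by case/andP: (miss_bounds 0 j w x (fun=> sk0)).
have S0 x n : 0 <= S x n by exact: sumr_ge0.
have Scvg x : cvgn (S x).
  apply: (@nondecreasing_is_cvgn R).
    by apply/nondecreasing_seqP => n; rewrite /S big_nat_recr//= lerDl.
  by exists H => _ [n _ <-]; exact: bounded.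
pose h x := limn (S x).
exists h; split.
- rewrite /h (_ : S w = fun=> 0) ?lim_cst//; apply/funext => n.
  by apply: big1 => j _; exact: miss_target.
- move=> x; apply/andP; split; first by apply: limr_ge => //; exact: nearW.
  by apply: limr_le => //; apply: nearW => n; exact: bounded.
- move=> x xw.
  have SE n : S x n.+1 = 1 + app k0 (S ^~ n) x.
    rewrite /S big_nat_recl//= xw; congr (_ + _).
    rewrite /app; under [RHS]eq_bigr do rewrite mulr_sumr.
    rewrite exchange_big/=; apply: eq_bigr => j _.
    by rewrite /killed xw mul1r; apply: eq_bigr => y _; rewrite miss_const.
  have c1 : (fun n => S x n.+1) @ \oo --> h x.
    by rewrite (cvg_shiftS (S x)); exact: Scvg.
  have c2 : (fun n => S x n.+1) @ \oo --> 1 + app k0 h x.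
    under eq_cvg do rewrite SE.
    apply: cvgD; first exact: cvg_cst.
    apply: (@cvg_big _ _ _ _ _ add_continuous _ _ _ (fun y n => k0 x y * S y n)) => y _.
    by apply: cvgM; [exact: cvg_cst|exact: Scvg].
  exact: (cvg_unique _ c1 c2).
Qed.

End PotentialExistence.

Section MatrixEntries.
Variables (R : realType) (V : finType).
Implicit Types (A B : 'M[R]_#|V|) (P : nat -> 'M[R]_#|V|).

Lemma entry1 u v : entry (1 : 'M[R]_#|V|) u v = (u == v)%:R.
Proof. by rewrite /entry mxE (inj_eq enum_rank_inj). Qed.

Lemma entryM A B u v : entry (A * B) u v = \sum_y entry A u y * entry B y v.
Proof.
rewrite /entry mxE (reindex (@enum_rank V))//=.
by exists enum_val => y _; rewrite ?enum_rankK ?enum_valK.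
Qed.

Lemma entry_prod P s t u v :
  entry (\prod_(s.+1 <= r < (s + t).+1) P r) u v = trans (fun t => entry (P t)) s t u v.
Proof.
elim: t s u => [|t IH] s u; first by rewrite addn0 big_geq//= entry1.
rewrite big_ltn ?ltnS ?addnS ?ltnS ?leq_addr// entryM /=.
by apply: eq_bigr => y _; rewrite -IH addSn.
Qed.

Lemma stationary_gt0 (p : V -> R) A : stationary p A -> irreducible A ->
  transition_matrix A -> forall v, 0 < p v.
Proof.
move=> [[p0 p1] pA] irr [A01 _] v.
have pAt t : forall v, \sum_u p u * entry (A ^+ t) u v = p v.
  elim: t => [|t IH] {}v.
    rewrite expr0 (bigD1 v)//= entry1 eqxx mulr1 big1 ?addr0// => u /negbTE uv.
    by rewrite entry1 uv mulr0.
  rewrite exprSr -[RHS]pA; under eq_bigr do rewrite entryM mulr_sumr.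
  rewrite exchange_big/=; apply: eq_bigr => y _; rewrite -IH mulr_suml.
  by apply: eq_bigr => u _; rewrite mulrA.
have At0 t : forall u v, 0 <= entry (A ^+ t) u v.
  elim: t => [|t IH] u' v'; first by rewrite expr0 entry1 ler0n.
  rewrite exprSr entryM; apply: sumr_ge0 => y _; rewrite mulr_ge0//.
  by case/andP: (A01 y v').
have [u pu] : exists u, 0 < p u.
  apply: contrapT => np.
  have : \sum_v p v = 0.
    apply: big1 => u _; apply/eqP; rewrite eq_le p0 andbT leNgt.
    by apply/negP => pu; apply: np; exists u.
  by rewrite p1 => /eqP; rewrite oner_eq0.
have [t _ Auv] := irr u v.
rewrite -(pAt t) (bigD1 u)//= ltr_wpDr ?mulr_gt0//.
by apply: sumr_ge0 => u' _; rewrite mulr_ge0.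
Qed.

Lemma ln_card_ge : (2 <= #|V|)%N -> 1 / 2 <= ln (#|V|%:R : R).
Proof.
move=> V2; have V0 : (0 : R) < #|V|%:R by rewrite ltr0n; lia.
rewrite -ler_expR lnK ?posrE//.
have e0 := expR_gt0 (1 / 2 : R).
have : expR (1 / 2) <= 2 :> R.
  have := expR_ge1Dx (- (1 / 2) : R); rewrite expRN => h.
  have h' : 1 / 2 <= (expR (1 / 2))^-1 :> R by lra.
  by rewrite -lef_pV2 ?posrE//; lra.
by move=> h; apply: (le_trans h); rewrite ler_nat.
Qed.

End MatrixEntries.

Section Bounds.
Variables (R : realType) (V : finType) (p : V -> R) (K : nat -> V -> V -> R) (H : R).
Hypotheses (p_gt0 : forall v, 0 < p v) (p1 : \sum_v p v = 1).
Hypotheses (sK : forall t, stochastic (K t.+1)) (rK : forall t, rev_wrt p (K t.+1)).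
Hypothesis H1 : 1 <= H.
Hypothesis pot : forall t w, exists h, hit_potential H (K t.+1) w h.

Let H_gt0 : 0 < H. Proof. exact: lt_le_trans H1. Qed.

Lemma uncov_series_le (k a : nat) (U : {set V}) (x : {ffun 'I_k -> V}) :
  (0 < k)%N -> (0 < a)%N -> (0 < #|U|)%N ->
  (forall s u v, p v / 2 <= trans K s a u v) ->
  (\sum_(t <oo) (uncov K 0 t U x)%:E <=
    (8 * a%:R + 16 * (H * ((1 + ln #|U|%:R) / k%:R)))%:E)%E.
Proof.
move=> k0 a0 U0 sep.
have kR : 0 < k%:R :> R by rewrite ltr0n.
have UR : 0 < #|U|%:R :> R by rewrite ltr0n.
have l0 : 0 <= ln #|U|%:R :> R by rewrite ln_ge0// ler1n.
set c := H * _; have c0 : 0 <= c.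
  by rewrite mulr_ge0 ?ltW// divr_gt0//; lra.
pose b := (Num.truncn (4 * c)).+1.
have bge : 4 * c <= b%:R by rewrite ltW// truncnS_gt.
have ble : b%:R <= 4 * c + 1.
  by rewrite /b -natr1 lerD2r; have := truncn_le (4 * c); rewrite mulr_ge0.
have epoch s (y : {ffun 'I_k -> V}) : uncov K s (a + b) U y <= 3 / 4.
  apply: (@uncov_epoch _ _ _ _ sK p (expR (- (b%:R / (2 * H))))) => //.
  - by move=> v; exact: ltW.
  - rewrite expR_ge0 -[X in _ <= X]expR0 ler_expR oppr_le0 divr_ge0//.
    by rewrite mulr_ge0// ltW.
  - by move=> w; exact: (mean_miss_le p_gt0 p1 sK rK H1 pot).
  - move=> j kj; rewrite -expRM_natl -{1}(@lnK _ #|U|%:R) ?posrE// -expRD.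
    have jk : k%:R <= 2 * j%:R :> R by rewrite -natrM ler_nat mul2n.
    have : ln #|U|%:R + j%:R * - (b%:R / (2 * H)) <= -1.
      have e : 1 + ln #|U|%:R = 4 * c * (k%:R / 2) / (2 * H) :> R.
        by rewrite /c; field; rewrite !gt_eqF.
      have : 4 * c * (k%:R / 2) / (2 * H) <= j%:R * (b%:R / (2 * H)).
        rewrite mulrA ler_pM2r ?invr_gt0 ?mulr_gt0// [leRHS]mulrC.
        apply: ler_pM => //; first by rewrite mulr_ge0.
        by rewrite ler_pdivrMr// mulrC.
      by rewrite -e; lra.
    move=> le1; apply: (@le_trans _ _ (expR (-1))); first by rewrite ler_expR.
    rewrite expRN mul1r lef_pV2 ?posrE ?expR_gt0//.
    by have := expR_ge1Dx (1 : R); lra.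
have a1 : 1 <= a%:R :> R by rewrite ler1n.
apply: (@le_trans _ _ ((4 * (a + b)%:R)%:E)); last first.
  by rewrite lee_fin natrD; lra.
apply: lime_le.
  apply: is_cvg_nneseries => n _ _; rewrite lee_fin.
  by case/andP: (uncov_bounds sK 0 n U x).
apply: nearW => n; rewrite sumEFin lee_fin.
by apply: sum_uncov_le => //; rewrite addn_gt0 a0.
Qed.

End Bounds.

Section Chains.
Variables (R : realType) (V : finType) (P : nat -> 'M[R]_#|V|) (p : V -> R).
Hypothesis V2 : (2 <= #|V|)%N.
Hypothesis hP : forall t, (1 <= t)%N ->
  [/\ transition_matrix (P t), irreducible (P t), stationary p (P t)
    & reversible p (P t)].
Hypothesis HIT_fin : (t_HIT P < +oo)%E.

Notation K := (fun t => entry (P t)).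
Notation H := (fine (t_HIT P)).

Lemma entry_stochastic t : stochastic (K t.+1).
Proof.
have [[P01 P1] _ _ _] := hP (ltn0Sn t).
by split=> // u v; case/andP: (P01 u v).
Qed.

Lemma two_points : exists x w : V, x != w.
Proof.
have /card_gt1P[x [w [_ _ xw]]] : (1 < #|V|)%N by [].
by exists x, w.
Qed.

Lemma sum_miss_le_HIT t (n : nat) x w :
  ((\sum_(0 <= j < n) miss (fun=> K t.+1) 0 j w x)%:E <= t_HIT P)%E.
Proof.
have [tP _ _ _] := hP (ltn0Sn t).
have [e ex] := cond_values_inhabited x (fun y => tau_hit R y w) tP.
apply: (@le_trans _ _ e); last first.
  apply: (@le_trans _ _ (t_hit 1 (fun=> P t.+1))).
    by apply: ereal_sup_ubound; exists (fun=> x), w.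
  by apply: ereal_sup_ubound; exists t.+1.
have sK : forall r, stochastic ((fun=> K t.+1) r.+1 : V -> V -> R).
  by move=> _; exact: entry_stochastic.
have u0 j (y : {ffun 'I_1 -> V}) : 0 <= uncov (fun=> K t.+1) 0 j [set w]%SET y.
  by case/andP: (@uncov_bounds _ _ 1 (fun=> K t.+1) sK 0 j [set w]%SET y).
rewrite (cond_values_tau_hit ex).
apply: le_trans (nneseries_lim_ge n _); last by move=> j _ _; rewrite lee_fin.
rewrite sumEFin lee_fin; apply: ler_sum => j _.
by rewrite (@uncov_set1 _ _ 1 (fun=> K t.+1)) big_ord1 ffunE.
Qed.

Lemma HIT_ge1 : (1 <= t_HIT P)%E.
Proof.
have [x [w xw]] := two_points.
by have := sum_miss_le_HIT 0 1 x w; rewrite big_nat1/= xw.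
Qed.

Lemma HIT_real : t_HIT P = H%:E.
Proof.
rewrite fineK// fin_numE gt_eqF ?lt_eqF//.
exact: lt_le_trans (ltNyr 1) HIT_ge1.
Qed.

Lemma H_ge1 : 1 <= H.
Proof. by rewrite -lee_fin -HIT_real HIT_ge1. Qed.

Lemma chain_potential t w : exists h, hit_potential H (K t.+1) w h.
Proof.
apply: hit_potential_exists; first exact: entry_stochastic.
by move=> n x; rewrite -lee_fin -HIT_real; exact: sum_miss_le_HIT.
Qed.

Lemma common_stationary_gt0 v : 0 < p v.
Proof.
by have [tP irr st _] := hP (leqnn 1); exact: stationary_gt0 st irr tP v.
Qed.

Lemma common_stationary_sum : \sum_v p v = 1.
Proof. by have [_ _ [[_ ?] _] _] := hP (leqnn 1). Qed.

Lemma chain_reversible t : rev_wrt p (K t.+1).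
Proof. by have [_ _ _ +] := hP (ltn0Sn t). Qed.

Let series_le k a := @uncov_series_le R V p K H common_stationary_gt0 common_stationary_sum entry_stochastic
  chain_reversible H_ge1 chain_potential k a.

Lemma t_hit_le k a : (0 < k)%N -> (0 < a)%N ->
  (forall s u v, p v / 2 <= trans K s a u v) ->
  (t_hit k P <= (8 * a%:R + 16 * (H * k%:R^-1))%:E)%E.
Proof.
move=> k0 a0 sep; apply: ge_ereal_sup => e [x [w /cond_values_tau_hit ->]].
apply: le_trans (series_le _ k0 a0 _ sep) _; first by rewrite cards1.
by rewrite cards1 ln1 addr0 mul1r.
Qed.

Lemma t_cov_le k a : (0 < k)%N -> (0 < a)%N ->
  (forall s u v, p v / 2 <= trans K s a u v) ->
  (t_cov k P <= (8 * a%:R + 48 * (H * (ln #|V|%:R / k%:R)))%:E)%E.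
Proof.
move=> k0 a0 sep; apply: ge_ereal_sup => e [x /cond_values_tau_cov ->].
apply: le_trans (series_le _ k0 a0 _ sep) _; first by rewrite cardsT; lia.
rewrite cardsT lee_fin lerD2l.
have -> : 48 * (H * (ln #|V|%:R / k%:R)) = 16 * (H * (3 * ln #|V|%:R / k%:R)) by field; rewrite pnatr_eq0; lia.
rewrite ler_pM2l// ler_pM2l ?(lt_le_trans ltr01 H_ge1)//.
rewrite ler_pM2r ?invr_gt0 ?ltr0n//.
by have := ln_card_ge R V2; lra.
Qed.

Lemma t_sep_attained : t_sep p P = +oo%E \/
  exists a, [/\ (0 < a)%N, t_sep p P = (a%:R)%:E &
    forall s u v, p v / 2 <= trans K s a u v].
Proof.
have [[]|[a [sepa _ sepE]]] := inf_time_attained R [set t | (sep_dist p P t <= (1 / 2)%:E)%E].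
  by left.
right; exists a.
have sep s u v : p v / 2 <= trans K s a u v.
  have : ((1 - trans K s a u v / p v)%:E <= (1 / 2)%:E :> \bar R)%E.
    by apply: le_trans sepa; apply: ereal_sup_ubound; exists s, u, v; rewrite entry_prod.
  rewrite lee_fin => h; have : 1 / 2 <= trans K s a u v / p v by lra.
  by rewrite ler_pdivlMr ?common_stationary_gt0//; lra.
split=> //; rewrite lt0n; apply/eqP => a0.
have [x [w xw]] := two_points.
have := sep 0%N x w; rewrite a0 /= (negbTE xw) mulr0n.
by have := common_stationary_gt0 w; lra.
Qed.

Hypothesis lP : forall t, (1 <= t)%N -> lazy (P t).

Lemma lazy_trans_ge : exists a, [/\ (0 < a)%N, a%:R <= 6 * H &
  forall s u v, p v / 2 <= trans K s a u v].
Proof.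
have H1 := H_ge1; pose T := (Num.truncn (2 * H)).+1.
have Tge : 2 * H <= T%:R by rewrite ltW// truncnS_gt.
have Tle : T%:R <= 2 * H + 1.
  rewrite /T -natr1 lerD2r; have := truncn_le (2 * H); rewrite mulr_ge0//.
  by lra.
exists (T + T)%N; split; first by [].
  by rewrite natrD; lra.
move=> s u v; apply: (lazy_separation common_stationary_gt0 common_stationary_sum entry_stochastic chain_reversible H1 chain_potential _ _ _ _ Tge).
by move=> t; exact: lP.
Qed.

End Chains.

Unset Implicit Arguments.

Theorem theorem1p4 (R : realType) :
  exists2 C : R, 0 < C &
  forall (V : finType) (P : nat -> 'M[R]_#|V|) (p : V -> R),
    (2 <= #|V|)%N ->
    (forall t, (1 <= t)%N ->
       [/\ transition_matrix (P t), irreducible (P t), stationary p (P t)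
         & reversible p (P t)]) ->
    (t_HIT P < +oo)%E ->
    ((forall k, (1 <= k)%N ->
        (t_hit k P <= C%:E * (t_sep p P + t_HIT P * (k%:R^-1)%:E))%E) /\
     ((forall t, (1 <= t)%N -> lazy (P t)) ->
        (t_hit 1 P <= C%:E * t_HIT P)%E)) /\
    ((forall k, (1 <= k)%N ->
        (t_cov k P <= C%:E *
           (t_sep p P + t_HIT P * (ln (#|V|%:R) / k%:R)%:E))%E) /\
     ((forall t, (1 <= t)%N -> lazy (P t)) ->
        (t_cov 1 P <= C%:E * (t_HIT P * (ln (#|V|%:R))%:E))%E)).
Proof.
exists 144 => // V P p V2 hP HIT_fin.
have HE := HIT_real V2 hP HIT_fin; have H1 := H_ge1 V2 hP HIT_fin.
have lnV := ln_card_ge R V2.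
have infinite_sep r : (144%:E * (+oo + t_HIT P * r%:E) = +oo :> \bar R)%E.
  by rewrite HE -EFinM addye// gt0_muley// lte_fin.
have finite_sep (a r : R) :
    (144%:E * (a%:E + t_HIT P * r%:E) = (144 * (a + fine (t_HIT P) * r))%:E)%E.
  by rewrite HE.
split; split=> [k k1|lP].
- have [->|[a [a0 -> sep]]] := t_sep_attained V2 hP.
    by rewrite infinite_sep leey.
  apply: (le_trans (t_hit_le V2 hP HIT_fin k1 a0 sep)).
  rewrite finite_sep lee_fin.
  have : 0 <= a%:R :> R by [].
  have : 0 <= fine (t_HIT P) * k%:R^-1 by rewrite mulr_ge0 ?invr_ge0//; lra.
  lra.
- have [a [a0 aH sep]] := lazy_trans_ge V2 hP HIT_fin lP.
  apply: (le_trans (t_hit_le V2 hP HIT_fin (ltn0Sn 0) a0 sep)).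
  by rewrite HE -EFinM lee_fin invr1; lra.
- have [->|[a [a0 -> sep]]] := t_sep_attained V2 hP.
    by rewrite infinite_sep leey.
  apply: (le_trans (t_cov_le V2 hP HIT_fin k1 a0 sep)).
  rewrite finite_sep lee_fin.
  have : 0 <= a%:R :> R by [].
  have : 0 <= fine (t_HIT P) * (ln #|V|%:R / k%:R).
    by rewrite mulr_ge0 ?divr_ge0//; lra.
  lra.
- have [a [a0 aH sep]] := lazy_trans_ge V2 hP HIT_fin lP.
  apply: (le_trans (t_cov_le V2 hP HIT_fin (ltn0Sn 0) a0 sep)).
  rewrite (_ : (_ * (_ * _))%E = (144 * (fine (t_HIT P) * ln #|V|%:R))%:E); last by rewrite HE.
  rewrite lee_fin divr1.
  have : fine (t_HIT P) * (1 / 2) <= fine (t_HIT P) * ln #|V|%:R.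
    by rewrite ler_pM2l//; lra.
  lra.
Qed.
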